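(* There is a unique graph $G\in\mathcal{G}_{6,11}$ which is $p$-optimal for all sufficiently large $p<1$, namely the simple graph with degree sequence $(4,4,4,4,3,3)$ in which the two vertices of degree $3$ are not adjacent (equivalently, $K_6$ with the edges of a path on four vertices and of a disjoint edge removed); it is a weak subdivision of the Petersen graph $P$. A different weak subdivision $G'\in\mathcal{G}_{6,11}$ of $P$ has a larger number of spanning trees than $G$, and is therefore strictly more reliable than $G$ for all sufficiently small $p>0$. In particular, there is no uniquely optimal graph in $\mathcal{G}_{6,11}$.
   Context: Graphs are finite connected multigraphs (multiple edges and loops allowed), considered up to isomorphism. $\mathcal{G}_{n,m}$ is the set of connected graphs with $n$ vertices and $m$ edges. For $p\in(0,1)$, $R(G,p)$ is the probability that $G$ remains connected (on all its vertices) when each edge is independently retained with probability $p$ and deleted otherwise. For $G,H\in\mathcal{G}_{n,m}$, $H$ is strictly more reliable than $G$ with respect to $p$ if $R(H,p)>R(G,p)$. A graph in $\mathcal{G}_{n,m}$ is $p$-optimal if it maximizes $R(\cdot,p)$ over $\mathcal{G}_{n,m}$; it is uniquely optimal if for all $p\in(0,1)$ it is strictly more reliable with respect to $p$ than every other graph in $\mathcal{G}_{n,m}$. A weak subdivision of a cubic graph $D$ is a graph obtained by assigning to each edge $e$ of $D$ a nonnegative integer weight $\ell(e)$ such that every cycle of $D$ has positive total weight, contracting each edge of weight $0$, and replacing each edge of weight $\ell\ge1$ by a path with $\ell$ edges. *)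

(* Defs.v *)
From HB Require Import structures.
From mathcomp Require Import all_boot all_order all_algebra reals.

Set Implicit Arguments.
Unset Strict Implicit.
Unset Printing Implicit Defensive.

Import Order.TTheory GRing.Theory Num.Theory.

(** Finite multigraphs, with loops and multiple edges.  The orientation of an
    edge given by [ends] is immaterial: the properties below only use [joins]
    or are symmetric in the two ends. *)
Record mgraph := MGraph {
  vert : finType;
  edge : finType;
  ends : edge -> vert * vert }.

Definition joins (G : mgraph) (e : edge G) (u v : vert G) : bool :=
  (ends e == (u, v)) || (ends e == (v, u)).

Definition iso (G H : mgraph) : Prop :=
  exists (f : vert G -> vert H) (g : edge G -> edge H),
    [/\ bijective f, bijective g &
        forall e u v, joins (g e) (f u) (f v) = joins e u v].

Section Graph.
Variable G : mgraph.
Implicit Types (S C : {set edge G}) (u v : vert G).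

(** A loop contributes 2. *)
Definition deg_in S v : nat :=
  \sum_(e in S) (((ends e).1 == v) + ((ends e).2 == v)).

Definition degree v : nat := deg_in [set: edge G] v.

Definition adj_in S u v : bool := [exists e in S, joins e u v].

Definition adjacent u v : bool := adj_in [set: edge G] u v.

Definition spanning_connected S : bool :=
  [forall u, forall v, connect (adj_in S) u v].

Definition connected_graph : bool := spanning_connected [set: edge G].

(** A cycle, given by its edge set, is a nonempty connected 2-regular
    subgraph; loops and pairs of parallel edges are cycles. *)
Definition is_cycle C : bool :=
  [&& C != set0,
      [forall v, deg_in C v \in [:: 0; 2]] &
      [forall u, forall v,
        (0 < deg_in C u) && (0 < deg_in C v) ==> connect (adj_in C) u v]].

Definition acyclic S : bool :=
  [forall C : {set edge G}, (C \subset S) ==> ~~ is_cycle C].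

Definition spanning_tree S : bool := spanning_connected S && acyclic S.

Definition nb_spanning_trees : nat := #|[set S | spanning_tree S]|.

Definition simple_graph : Prop :=
  (forall e : edge G, (ends e).1 != (ends e).2) /\
  (forall (e e' : edge G) u v, joins e u v -> joins e' u v -> e = e').

Definition degree_sequence : seq nat :=
  sort geq [seq degree v | v <- enum (vert G)].

Definition cubic : bool := [forall v, degree v == 3].

End Graph.

(** The class G_{n,m}. *)
Definition in_class (n m : nat) (G : mgraph) : Prop :=
  [/\ connected_graph G, #|vert G| = n & #|edge G| = m].

Section WeakSubdivision.
Variables (D : mgraph) (l : edge D -> nat).

Definition zero_class (x : vert D) : {set vert D} :=
  [set y | connect (adj_in [set e | l e == 0]) x y].

Definition contracted : finType := {B : {set vert D} | B \in codom zero_class}.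

Definition contract (x : vert D) : contracted :=
  exist (fun B => B \in codom zero_class) (zero_class x) (codom_f zero_class x).

(** An edge [e] with [0 < l e] has [(l e).-1] interior vertices. *)
Definition wsub_vert : finType := (contracted + {e : edge D & 'I_(l e).-1})%type.

Definition wsub_edge : finType := {e : edge D & 'I_(l e)}.

(** For [0 < l e] and [k <= l e], the [k]-th vertex of the path replacing [e];
    [insub k.-1] fails exactly for [k = l e] when [0 < k <= l e]. *)
Definition path_vertex (e : edge D) (k : nat) : wsub_vert :=
  if k == 0 then inl (contract (ends e).1)
  else if insub k.-1 is Some i
  then inr (Tagged (fun e => 'I_(l e).-1) (i : 'I_(l e).-1))
  else inl (contract (ends e).2).

Definition wsub_ends (a : wsub_edge) : wsub_vert * wsub_vert :=
  (path_vertex (tag a) (tagged a), path_vertex (tag a) (tagged a).+1).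

Definition wsub : mgraph := MGraph wsub_ends.

End WeakSubdivision.

Definition weak_subdivision (D H : mgraph) : Prop :=
  [/\ connected_graph D, cubic D &
      exists l : edge D -> nat,
        (forall C : {set edge D}, is_cycle C -> 0 < \sum_(e in C) l e) /\
        iso H (wsub l)].

(** The Petersen graph as the generalized Petersen graph GP(5,2): outer
    vertices [inl i], inner vertices [inr i], indices modulo 5. *)
Definition petersen_ends (a : 'I_5 + 'I_5 + 'I_5) :
    ('I_5 + 'I_5) * ('I_5 + 'I_5) :=
  match a with
  | inl (inl i) => (inl i, inl (i + 1)%R)
  | inl (inr i) => (inl i, inr i)
  | inr i => (inr i, inr (i + 2%:R)%R)
  end.

Definition petersen : mgraph := MGraph petersen_ends.

(** K_6 minus the edges of the path 0-1-2-3 and the edge 4-5; the edge with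
    ends [i < j] is the pair [(i, j)]. *)
Definition K6_minus_P4_K2_edge : finType :=
  {a : 'I_6 * 'I_6 | (a.1 < a.2) &&
     ((val a.1, val a.2) \notin [:: (0, 1); (1, 2); (2, 3); (4, 5)])}.

Definition K6_minus_P4_K2 : mgraph :=
  MGraph (fun a : K6_minus_P4_K2_edge => val a).

Section Reliability.
Variable R : realType.
Local Open Scope ring_scope.

Definition reliability (G : mgraph) (p : R) : R :=
  \sum_(S : {set edge G} | spanning_connected S)
    \prod_(e : edge G) (if e \in S then p else 1 - p).

Definition more_reliable (p : R) (H G : mgraph) : Prop :=
  reliability G p < reliability H p.

Definition p_optimal (n m : nat) (p : R) (G : mgraph) : Prop :=
  in_class n m G /\
  forall H, in_class n m H -> reliability H p <= reliability G p.

Definition uniquely_optimal (n m : nat) (G : mgraph) : Prop :=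
  in_class n m G /\
  forall p : R, 0 < p < 1 ->
  forall H, in_class n m H -> ~ iso H G -> more_reliable p G H.

Definition for_large_p (Q : R -> Prop) : Prop :=
  exists2 p0 : R, 0 < p0 < 1 & forall p, p0 < p < 1 -> Q p.

Definition for_small_p (Q : R -> Prop) : Prop :=
  exists2 p0 : R, 0 < p0 < 1 & forall p, 0 < p < p0 -> Q p.

End Reliability.

Arguments uniquely_optimal : clear implicits.

(* Main.v *)
Require Import Defs.
From mathcomp Require Import all_boot all_order all_algebra reals.
From mathcomp Require Import zify lra.

(** For a graph with [m] edges, the reliability is the sum over [k] of
    [N_k p^k (1-p)^(m-k)], where [N_k] is the number of spanning connected sets of
    [k] edges ([nb_conn]). Near [p = 1] the comparison of two graphs is decided by
    the last index at which their [N_k] differ, near [p = 0] by the first one, and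
    uniformly so, since the [N_k] are bounded by binomials ([lex_ltr]).

    Near 1, equivalently, the numbers [D_1, D_2, D_3, D_4] of disconnecting sets
    of 1, 2, 3 and 4 edges are to be minimized lexicographically. The key fact is
    that the symmetric difference of two edge boundaries is an edge boundary
    ([boundary_symdiff]). Let [H] have 6 vertices and 11 edges with
    [D_1 = D_2 = 0]: then the boundary of a nonempty proper set of vertices has at
    least three edges, so boundaries of distinct vertices are far apart. As the
    degrees sum to 22, at least two vertices have a boundary of size 3, so
    [D_3 >= 2]. If [D_3 = 2], there is no loop, the degrees are 4, 4, 4, 4, 3, 3,
    and the sets of four edges containing the boundary of a vertex are already 20 in number,
    so [D_4 >= 20]. If [D_4 = 20], the boundary of a pair of vertices cannot have
    size 3 or 4, since such a boundary would contain that of a vertex; hence there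
    are no multiple edges, and the two vertices of degree 3 are not adjacent
    ([near_regular_of_disc]). Looking at nonadjacent pairs, one sees that these
    properties determine the graph ([near_regular_iso]). The numbers [N_k] of this
    graph [optG] are evaluated from a list of its edges: it has
    [D_1, D_2, D_3, D_4 = 0, 0, 2, 20], so it is the only optimal graph near 1.

    Spanning trees are the spanning connected sets of 5 edges ([spanning_treeE]).
    There are 224 of them in [optG] and 225 in [treeG], so the latter is more
    reliable near 0. Both graphs arise from the Petersen graph by contracting a
    matching of four edges; every cycle then keeps an edge of positive weight
    ([petersen_contraction]). *)

Set Implicit Arguments.
Unset Strict Implicit.
Unset Printing Implicit Defensive.

Import Order.TTheory GRing.Theory Num.Theory.

(** * Connectivity and incidence *)

Lemma connect_invariant (T : finType) (r : rel T) (P : pred T) x y :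
  (forall a b, P a -> r a b -> P b) -> connect r x y -> P x -> P y.
Proof.
move=> rP /connectP[p rp ->] {y}.
elim: p x rp => //= z p IHp x /andP[rxz rp] Px.
by apply: IHp rp _; apply: rP rxz.
Qed.

(** The contribution of an edge to the degree of a vertex. *)
Definition inc (G : mgraph) (e : edge G) (v : vert G) : nat :=
  ((ends e).1 == v) + ((ends e).2 == v).

Section Connectivity.
Variable G : mgraph.
Implicit Types (S T C : {set edge G}) (e : edge G) (u v w x y : vert G).

Lemma joinsC e u v : joins e u v = joins e v u.
Proof. by rewrite /joins orbC. Qed.

Lemma joins_ends e : joins e (ends e).1 (ends e).2.
Proof. by rewrite /joins -surjective_pairing eqxx. Qed.

Lemma joinsP e u v :
  reflect (ends e = (u, v) \/ ends e = (v, u)) (joins e u v).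
Proof. by apply: (iffP orP) => -[/eqP|/eqP]; auto. Qed.

Lemma adj_inP S u v : reflect (exists2 e, e \in S & joins e u v) (adj_in S u v).
Proof.
by apply: (iffP existsP) => [[e /andP[]]|[e eS uv]]; exists e => //; apply/andP.
Qed.

Lemma adj_in_sym S : symmetric (adj_in S).
Proof. by move=> u v; apply/adj_inP/adj_inP => -[e eS]; exists e; rewrite // joinsC. Qed.

Lemma adjacentP u v : reflect (exists e : edge G, joins e u v) (adjacent u v).
Proof. by apply: (iffP (adj_inP _ _ _)) => -[e]; exists e; rewrite ?inE. Qed.

Lemma connect_adjC S : connect_sym (adj_in S).
Proof. exact: sym_connect_sym (adj_in_sym S). Qed.

Lemma connect_ends S e : e \in S -> connect (adj_in S) (ends e).1 (ends e).2.
Proof. by move=> eS; apply/connect1/adj_inP; exists e => //; apply: joins_ends. Qed.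

Lemma connect_adjW S T u v :
  S \subset T -> connect (adj_in S) u v -> connect (adj_in T) u v.
Proof.
move=> sST; apply: connect_sub => x y /adj_inP[e eS xy].
by apply/connect1/adj_inP; exists e => //; apply: subsetP eS.
Qed.

Lemma connect_setU1 S e x y :
  connect (adj_in (e |: S)) x y =
  [|| connect (adj_in S) x y,
      connect (adj_in S) x (ends e).1 && connect (adj_in S) (ends e).2 y |
      connect (adj_in S) x (ends e).2 && connect (adj_in S) (ends e).1 y].
Proof.
set u := (ends e).1; set v := (ends e).2.
pose P z := [|| connect (adj_in S) x z,
    connect (adj_in S) x u && connect (adj_in S) v z |
    connect (adj_in S) x v && connect (adj_in S) u z].
rewrite -/(P y); apply/idP/idP => [xy|].
  apply: (connect_invariant (P := P)) xy _; last by rewrite /P connect0.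
  rewrite /P.
  move=> a b + /adj_inP[f /setU1P[->|fS] ab]; last first.
    have cab : connect (adj_in S) a b by apply/connect1/adj_inP; exists f.
    case/or3P=> [h|/andP[h1 h2]|/andP[h1 h2]].
    - by rewrite (connect_trans h cab).
    - by rewrite h1 (connect_trans h2 cab) orbT.
    - by rewrite h1 (connect_trans h2 cab) !orbT.
  have uv : (a, b) = (u, v) \/ (a, b) = (v, u).
    by case/joinsP: ab; rewrite [ends e]surjective_pairing => -[<- <-]; auto.
  by case: uv => -[-> ->] /or3P[h|/andP[h1 h2]|/andP[h1 h2]];
    rewrite ?h ?h1 ?h2 ?connect0 ?orbT ?andbT.
have mono a b := @connect_adjW S (e |: S) a b (subsetUr _ _).
have uv : connect (adj_in (e |: S)) u v by apply: connect_ends; rewrite setU11.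
case/or3P => [/mono //|/andP[/mono h1 /mono h2]|/andP[/mono h1 /mono h2]].
  exact: connect_trans h1 (connect_trans uv h2).
by rewrite connect_adjC in uv; apply: connect_trans h1 (connect_trans uv h2).
Qed.

Lemma spanning_connectedP S :
  reflect (forall u v, connect (adj_in S) u v) (spanning_connected S).
Proof. by apply: (iffP forallP) => cS u; [move=> v; apply: (forallP (cS u)) | apply/forallP]. Qed.

Lemma spanning_connectedW S T :
  S \subset T -> spanning_connected S -> spanning_connected T.
Proof.
by move=> sST /spanning_connectedP cS; apply/spanning_connectedP => u v; apply: connect_adjW sST _.
Qed.

Lemma deg_inE S v : deg_in S v = \sum_(e in S) inc e v.
Proof. by []. Qed.

Lemma degreeE v : degree v = \sum_e inc e v.
Proof. by rewrite /degree deg_inE; apply: eq_bigl => e; rewrite inE. Qed.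

Lemma deg_inU1 S e v : e \notin S -> deg_in (e |: S) v = inc e v + deg_in S v.
Proof. exact: big_setU1. Qed.

Lemma sum_inc (A : {set vert G}) e :
  \sum_(v in A) inc e v = ((ends e).1 \in A) + ((ends e).2 \in A).
Proof.
have sum_eq (x : vert G) : \sum_(v in A) (x == v) = (x \in A) :> nat.
  rewrite -big_mkcondr /= sum1dep_card.
  rewrite (_ : [set v | _] = if x \in A then [set x] else set0).
    by case: ifP; rewrite ?cards1 ?cards0.
  apply/setP => v; rewrite inE; case: ifP => xA; rewrite inE ?[v == x]eq_sym.
    by case: eqP => [<-|]; rewrite ?xA ?andbF.
  by case: eqP => [<-|]; rewrite ?xA ?andbF.
by rewrite big_split /= !sum_eq.
Qed.

Lemma handshake : \sum_(v : vert G) degree v = 2 * #|edge G|.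
Proof.
under eq_bigr do rewrite degreeE.
rewrite exchange_big /=.
under eq_bigr => e _.
  rewrite (eq_bigl (mem [set: vert G])); last by move=> v; rewrite !inE.
  rewrite sum_inc !inE; over.
by rewrite sum_nat_const mulnC.
Qed.

End Connectivity.

(** * Spanning trees *)

Section Trees.
Variable G : mgraph.
Implicit Types (S T C P : {set edge G}) (e : edge G) (u v w x y : vert G).

(** A connected edge set contains trees of every size grown from [r]. *)
Lemma grow_tree S r k : spanning_connected S -> k < #|vert G| ->
  exists T (W : {set vert G}),
    [/\ T \subset S, #|T| = k, #|W| = k.+1,
        (forall e, e \in T -> ((ends e).1 \in W) && ((ends e).2 \in W)) &
        forall x, x \in W -> connect (adj_in T) r x].
Proof.
move=> /spanning_connectedP cS; elim: k => [|k IHk] kn.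
  exists set0, [set r]; split; rewrite ?sub0set ?cards0 ?cards1 //.
    by move=> e; rewrite in_set0.
  by move=> x /set1P->.
have [T [W [sTS cT cW endsW WT]]] := IHk (ltnW kn).
have [a [b [aW bNW /adj_inP[e eS abe]]]] :
    exists a b, [/\ a \in W, b \notin W & adj_in S a b].
  have [y yNW] : exists y, y \notin W.
    apply/existsP; rewrite -negb_forall; apply: contraL kn => /forallP WT'.
    by rewrite -leqNgt -cW subset_leq_card //; apply/subsetP.
  have [x xW] : exists x, x \in W by apply/set0Pn; rewrite -card_gt0 cW.
  case: (boolP [exists a, [exists b, [&& a \in W, b \notin W & adj_in S a b]]]).
    by move=> /existsP[a /existsP[b /and3P[]]]; exists a, b.
  move=> Wcl; case/negP: yNW.
  apply: (connect_invariant (P := fun z => z \in W)) (cS x y) xW => a b aW ab.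
  apply: contraR Wcl => bNW; apply/existsP; exists a; apply/existsP; exists b.
  by rewrite aW bNW ab.
have eNT : e \notin T.
  apply: contra bNW => /endsW.
  by case/joinsP: abe => -> /= /andP[].
exists (e |: T), (b |: W); split.
- by rewrite subUset sub1set eS.
- by rewrite cardsU1 eNT cT.
- by rewrite cardsU1 bNW cW.
- move=> f /setU1P[->|/endsW/andP[f1 f2]].
    by case/joinsP: abe => -> /=; rewrite !inE aW eqxx /= orbT.
  by rewrite !inE f1 f2 !orbT.
- move=> x /setU1P[->|/WT]; last by apply: connect_adjW; apply: subsetUr.
  apply: connect_trans (connect_adjW (subsetUr _ _) (WT a aW)) _.
  by apply/connect1/adj_inP; exists e; rewrite ?setU11.
Qed.

Lemma connected_subtree S : spanning_connected S ->
  exists2 T : {set edge G}, T \subset S & spanning_connected T /\ #|T| = #|vert G|.-1.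
Proof.
move=> cS; have [V0|Vpos] := posnP #|vert G|.
  exists set0; rewrite ?sub0set // cards0 V0; split=> //.
  by apply/spanning_connectedP => u v; move: V0; rewrite (cardD1 u) inE.
have [r _] : exists r : vert G, r \in vert G by apply/card_gt0P.
have kn : #|vert G|.-1 < #|vert G| by rewrite prednK.
have [T [W [sTS cT cW _ WT]]] := grow_tree r cS kn.
exists T => //; split=> //.
have WE : W = setT by apply/eqP; rewrite eqEcard subsetT cardsT cW prednK /=.
have rT x : connect (adj_in T) r x by apply: WT; rewrite WE.
apply/spanning_connectedP => u v; apply: connect_trans (rT v).
by rewrite connect_adjC.
Qed.

Lemma leq_card_connected S : spanning_connected S -> #|vert G|.-1 <= #|S|.
Proof. by case/connected_subtree => T sTS [_ <-]; apply: subset_leq_card. Qed.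

(** The edges of a simple path: every vertex of the path has degree 2, up to
    the two ends, and the other vertices have degree 0. *)
Lemma path_edges T x p : path (adj_in T) x p -> uniq (x :: p) ->
  exists P, [/\ P \subset T,
     (forall w, deg_in P w + (x == w) + (last x p == w) = 2 * (w \in x :: p)) &
     (forall w, w \in x :: p -> connect (adj_in P) x w)].
Proof.
elim: p x => [x _ _|y p IHp x /= /andP[/adj_inP[e eT xye] yp] /and3P[xNp yNp Up]].
  exists set0; split=> [|w|w]; rewrite ?sub0set //.
    by rewrite deg_inE big_set0 inE /= [w == x]eq_sym; case: eqP.
  by rewrite inE => /eqP->.
have [|P [sPT degP conP]] := IHp y yp; first by rewrite /= yNp.
have incE w : inc e w = (x == w) + (y == w).
  by rewrite /inc; case/joinsP: xye => -> //=; rewrite addnC.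
have eNP : e \notin P.
  have := degP x; rewrite (negPf xNp) deg_inE.
  case: (boolP (e \in P)) => // eP.
  by rewrite (big_setD1 e) //= incE eqxx.
exists (e |: P); split=> [|w|w].
- by rewrite subUset sub1set eT.
- rewrite deg_inU1 // incE /= [w \in x :: _]in_cons.
  have := degP w; move: xNp; rewrite [w == x]eq_sym.
  by case: (x =P w) => [->|_] xNp /=; rewrite ?(negPf xNp); lia.
- rewrite in_cons => /predU1P[->//|/conP yw].
  apply: connect_trans (connect_adjW (subsetUr _ _) yw).
  by apply/connect1/adj_inP; exists e; rewrite ?setU11.
Qed.

(** Adding to [T] an edge whose ends are connected in [T] closes a cycle. *)
Lemma cycle_of_connect T e : e \notin T ->
  connect (adj_in T) (ends e).1 (ends e).2 ->
  exists2 C : {set edge G}, C \subset e |: T & is_cycle C.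
Proof.
move=> eNT /connectP[p0 path0 last0].
have [p [pathp Up lastp]] : exists p, [/\ path (adj_in T) (ends e).1 p,
    uniq ((ends e).1 :: p) & last (ends e).1 p = (ends e).2].
  by case/shortenP: path0 last0 => p pp Up _ ->; exists p.
have [P [sPT degP conP]] := path_edges pathp Up.
have eNP : e \notin P by apply: contra eNT; apply: subsetP.
have degC w : deg_in (e |: P) w = 2 * (w \in (ends e).1 :: p).
  by rewrite deg_inU1 // -degP lastp /inc; lia.
exists (e |: P); first by rewrite setUS.
apply/and3P; split.
- by apply/set0Pn; exists e; rewrite setU11.
- by apply/forallP => w; rewrite degC; case: (w \in _).
apply/forallP => x; apply/forallP => y; rewrite !degC.
apply/implyP; case xp: (x \in _); case yp: (y \in _) => //= _.
apply: (connect_adjW (subsetUr [set e] P)).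
apply: connect_trans (conP _ yp); rewrite connect_adjC; exact: conP xp.
Qed.

(** An edge of a cycle is not a bridge: otherwise its end [u] would be the only
    vertex of odd degree in its component once the edge is removed. *)
Lemma cycle_edge_connect C e : is_cycle C -> e \in C ->
  connect (adj_in (C :\ e)) (ends e).1 (ends e).2.
Proof.
move=> /and3P[_ /forallP degC _] eC; set u := (ends e).1; set v := (ends e).2.
apply: contraT => Nuv.
pose K := [set w | connect (adj_in (C :\ e)) u w].
have sumK S : \sum_(w in K) deg_in S w
    = \sum_(f in S) (((ends f).1 \in K) + ((ends f).2 \in K)).
  under eq_bigr do rewrite deg_inE.
  by rewrite exchange_big; apply: eq_bigr => f _; rewrite sum_inc.
have even_sum (I : finType) (A : {set I}) (F : I -> nat) :
    (forall i, i \in A -> ~~ odd (F i)) -> ~~ odd (\sum_(i in A) F i).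
  by move=> evF; apply: (big_ind (fun n => ~~ odd n)) => // m n;
    rewrite oddD => /negPf-> /negPf->.
have evC : ~~ odd (\sum_(w in K) deg_in C w).
  by apply: even_sum => w _; have := degC w; rewrite !inE => /orP[]/eqP->.
have evCe : ~~ odd (\sum_(w in K) deg_in (C :\ e) w).
  rewrite sumK; apply: even_sum => f fC.
  have fuv := connect_ends fC.
  have -> : ((ends f).2 \in K) = ((ends f).1 \in K).
    by rewrite !inE; apply/idP/idP => /connect_trans-> //; rewrite connect_adjC.
  by rewrite addnn odd_double.
move: evC; rewrite sumK (big_setD1 e) //= -sumK oddD (negPf evCe).
by rewrite !inE -/u -/v connect0 (negPf Nuv).
Qed.

Lemma spanning_connectedD1 S C e : spanning_connected S ->
  C \subset S -> is_cycle C -> e \in C -> spanning_connected (S :\ e).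
Proof.
move=> /spanning_connectedP cS sCS cC eC; apply/spanning_connectedP => u v.
have ce := connect_adjW (setSD [set e] sCS) (cycle_edge_connect cC eC).
apply: connect_sub (cS u v) => x y /adj_inP[f fS xy].
have [fe|fNe] := eqVneq f e; last first.
  by apply/connect1/adj_inP; exists f => //; rewrite !inE fNe.
by case/joinsP: xy ce; rewrite fe => -> //=; rewrite connect_adjC.
Qed.

Lemma spanning_treeE S :
  spanning_tree S = spanning_connected S && (#|S| == #|vert G|.-1).
Proof.
rewrite /spanning_tree; case cS: (spanning_connected S) => //=.
apply/forallP/eqP => [acS | cardS C].
  have [T sTS [/spanning_connectedP cT <-]] := connected_subtree cS.
  apply/eqP; rewrite eq_sym eqn_leq subset_leq_card //=.
  apply: subset_leq_card; apply/subsetP => e eS; apply: contraT => eNT.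
  have [C sC cC] := cycle_of_connect eNT (cT _ _).
  have sCS : C \subset S by apply: subset_trans sC _; rewrite subUset sub1set eS.
  by have := acS C; rewrite sCS cC.
apply/implyP => sCS; apply/negP => cC.
have [e eC] : exists e, e \in C by apply/set0Pn; case/and3P: cC.
have := leq_card_connected (spanning_connectedD1 cS sCS cC eC).
by rewrite -cardS (cardsD1 e S) (subsetP sCS) // ltnn.
Qed.

End Trees.

(** * Counting connected edge sets *)

(** The number of spanning connected edge sets with [k] edges. *)
Definition nb_conn (G : mgraph) (k : nat) : nat :=
  #|[set S : {set edge G} | spanning_connected S & #|S| == k]|.

(** The number of sets of [k] edges whose deletion disconnects the graph. *)
Definition nb_disc (G : mgraph) (k : nat) : nat :=
  #|[set F : {set edge G} | ~~ spanning_connected (~: F) & #|F| == k]|.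

Section Counting.
Variable G : mgraph.

Lemma nb_spanning_treesE : nb_spanning_trees G = nb_conn G #|vert G|.-1.
Proof. by apply: eq_card => S; rewrite !inE spanning_treeE. Qed.

Lemma nb_conn_small k : k < #|vert G|.-1 -> nb_conn G k = 0.
Proof.
move=> kn; apply: eq_card0 => S; rewrite inE.
apply/andP => -[/leq_card_connected cS /eqP Sk].
by move: kn; rewrite -Sk ltnNge cS.
Qed.

Lemma nb_conn_disc k : k <= #|edge G| ->
  nb_conn G (#|edge G| - k) + nb_disc G k = 'C(#|edge G|, k).
Proof.
move=> km; rewrite -card_draws.
rewrite -(cardsID [set F : {set edge G} | spanning_connected (~: F)]).
congr (_ + _); last first.
  by apply: eq_card => F; rewrite !inE.
rewrite /nb_conn -(card_imset _ (can_inj (@setCK (edge G)))).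
apply: eq_card => F; rewrite !inE; apply/imsetP/andP => [[S]|[Fk cF]].
  rewrite !inE => /andP[cS /eqP Sk] ->; rewrite setCK cS; split=> //.
  by rewrite cardsCs setCK Sk subKn.
exists (~: F); rewrite ?setCK // !inE cF /=.
by rewrite cardsCs setCK (eqP Fk) cardT.
Qed.

End Counting.

(** * Graphs given by lists of edges *)

(** All bit sequences of length [n], by which the sets of [n] edges are
    enumerated. *)
Fixpoint bitmasks (n : nat) : seq bitseq :=
  if n is n'.+1 then
    map (cons true) (bitmasks n') ++ map (cons false) (bitmasks n')
  else [:: [::]].

Lemma size_bitmasks n : size (bitmasks n) = 2 ^ n.
Proof. by elim: n => //= n IHn; rewrite size_cat !size_map IHn expnS mul2n addnn. Qed.

Lemma mem_bitmasks n m : size m = n -> m \in bitmasks n.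
Proof.
elim: n m => [|n IHn] [|b m] //= [/IHn mn]; rewrite mem_cat; apply/orP.
by case: b; [left|right]; apply: map_f.
Qed.

Lemma size_mem_bitmasks n m : m \in bitmasks n -> size m = n.
Proof.
elim: n m => [|n IHn] m /=; first by rewrite inE => /eqP->.
by rewrite mem_cat => /orP[]/mapP[m' /IHn <- ->].
Qed.

Lemma card_sets_bitmasks (T : finType) (Q : pred {set T}) :
  #|[set S | Q S]|
    = count (fun m => Q [set x in mask m (enum T)]) (bitmasks #|T|).
Proof.
set f := fun m => [set x in mask m (enum T)].
have memf S : S \in map f (bitmasks #|T|).
  apply/mapP; exists [seq x \in S | x <- enum T].
    by apply: mem_bitmasks; rewrite size_map -cardE.
  by apply/setP => x; rewrite inE -filter_mask mem_filter mem_enum inE andbT.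
have Uf : uniq (map f (bitmasks #|T|)).
  have sub : {subset enum {set T} <= map f (bitmasks #|T|)} by move=> S _.
  apply: leq_size_uniq (enum_uniq _) sub _.
  rewrite size_map size_bitmasks -cardE -cardsT -card_powerset.
  by apply/subset_leq_card/subsetP.
rewrite -[count _ _]/(count (preim f Q) _) -count_map.
rewrite cardE -size_filter; apply/perm_size/uniq_perm.
- exact: enum_uniq.
- exact: filter_uniq.
- by move=> S; rewrite mem_enum inE mem_filter memf andbT.
Qed.

(** The graph with vertices [0, ..., n] whose [i]-th edge joins the two entries
    of the [i]-th pair of [es]; the entries are read modulo [n.+1]. *)
Definition lgraph (n : nat) (es : seq (nat * nat)) : mgraph :=
  MGraph (fun i : 'I_(size es) =>
    let a := nth (0, 0) es i in (inZp a.1 : 'I_n.+1, inZp a.2 : 'I_n.+1)).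

(** One step of the computation of components: in the list [l] of labels of the
    vertices, the labels of the two ends of the edge [a] become equal. *)
Definition merge_labels (a : nat * nat) (l : seq nat) : seq nat :=
  let s := nth 0 l a.1 in let t := nth 0 l a.2 in
  map (fun c => if c == s then t else c) l.

(** The list of the labels of the vertices [0, ..., N.-1], equal on a component of
    the graph with edge list [es]. *)
Definition components (N : nat) (es : seq (nat * nat)) : seq nat :=
  foldr merge_labels (iota 0 N) es.

Section ListGraphs.
Variables (n : nat) (es : seq (nat * nat)).
Let G := lgraph n es.

(** The ends of an edge as numbers. *)
Definition end_vals (e : edge G) : nat * nat := (val (ends e).1, val (ends e).2).

(** Two vertices are connected by the edges of [s] if and only if they carry the
    same label. *)
Lemma components_spec (s : seq (edge G)) (l := components n.+1 (map end_vals s)) :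
  size l = n.+1 /\
  forall x y : 'I_n.+1,
    connect (adj_in [set e in s] : rel (vert G)) x y = (nth 0 l x == nth 0 l y).
Proof.
rewrite /l {l}; elim: s => [|e s [IHsize IHs]].
  rewrite -[components _ _]/(iota 0 n.+1); split=> [|x y]; first by rewrite size_iota.
  rewrite !nth_iota // !add0n; apply/idP/eqP => [xy|/val_inj-> //].
  apply/eqP; apply: (connect_invariant (P := fun z => val x == val z)) xy _ => //.
  by move=> a b _ /adj_inP[e]; rewrite inE.
set l := components _ _ in IHsize IHs.
rewrite -[components _ _]/(merge_labels (end_vals e) l).
split=> [|x y]; first by rewrite size_map.
rewrite !(nth_map 0) ?IHsize // /end_vals /=.
rewrite set_cons.
apply: etrans (connect_setU1 (G := G) [set:: s] e x y) _; rewrite !IHs.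
set a := nth 0 l x; set b := nth 0 l y.
set c := nth 0 l _; set d := nth 0 l _.
by case: (a =P c); case: (b =P c); lia.
Qed.

Lemma spanning_connected_components (s : seq (edge G)) :
  spanning_connected [set e in s]
    = (let l := components n.+1 (map end_vals s) in all (pred1 (head 0 l)) l).
Proof.
have [sz spec] := components_spec s; set l := components _ _ in sz spec *.
rewrite /= -nth0; apply/spanning_connectedP/(all_nthP 0) => [cs i|const x y].
  by rewrite sz => i_n /=; rewrite eq_sym -(spec ord0 (Ordinal i_n)).
have l0 (z : 'I_n.+1) : nth 0 l z = nth 0 l 0.
  by apply/eqP; apply: const; rewrite sz.
by rewrite spec !l0.
Qed.

Lemma size_enum_edge : size (enum (edge G)) = size es.
Proof. exact: size_enum_ord. Qed.

Lemma end_vals_enum :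
  map end_vals (enum (edge G)) = [seq (a.1 %% n.+1, a.2 %% n.+1) | a <- es].
Proof.
apply: (@eq_from_nth _ (0, 0)); first by rewrite [LHS]size_map [RHS]size_map size_enum_edge.
move=> i; rewrite size_map size_enum_edge => i_es.
have i_enum : nth (Ordinal i_es) (enum (edge G)) i = i :> nat by apply: nth_enum_ord.
rewrite (nth_map (Ordinal i_es)) ?size_enum_edge // (nth_map (0, 0)) //.
by rewrite /end_vals /= i_enum.
Qed.

(** The right-hand side can be evaluated: it runs through all sublists of the
    list of edges and tests whether the vertices get a single label. *)
Lemma nb_conn_lgraph k :
  nb_conn G k =
  count (fun m =>
    (count id m == k) &&
    (let l := components n.+1
                (mask m [seq (a.1 %% n.+1, a.2 %% n.+1) | a <- es]) in
     all (pred1 (head 0 l)) l)) (bitmasks (size es)).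
Proof.
rewrite /nb_conn card_sets_bitmasks card_ord.
apply: eq_in_count => m mb.
have sz_m : size m = size (enum (edge G)).
  by rewrite size_enum_edge; move: mb; apply: size_mem_bitmasks.
rewrite spanning_connected_components map_mask end_vals_enum andbC; congr (_ && _).
by rewrite cardsE (card_uniqP _) ?mask_uniq ?enum_uniq // size_mask.
Qed.

Lemma joins_lgraph (e : 'I_(size es)) (u v : 'I_n.+1)
    (a := nth (0, 0) es e) :
  joins (e : edge G) u v = ((a.1 %% n.+1 == u) && (a.2 %% n.+1 == v))
                        || ((a.1 %% n.+1 == v) && (a.2 %% n.+1 == u)).
Proof. by rewrite /joins !xpair_eqE -!val_eqE. Qed.

Lemma adjacent_lgraph (u v : 'I_n.+1) :
  adjacent (u : vert G) v =
  has (fun a => ((a.1 %% n.+1 == u) && (a.2 %% n.+1 == v))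
             || ((a.1 %% n.+1 == v) && (a.2 %% n.+1 == u))) es.
Proof.
apply/adjacentP/(has_nthP (0, 0)) => [[e]|[i i_es uv]].
  by rewrite joins_lgraph; exists e.
by exists (Ordinal i_es); rewrite joins_lgraph.
Qed.

Lemma degree_lgraph (v : 'I_n.+1) :
  degree (v : vert G) = count (fun a => a.1 %% n.+1 == v) es
                      + count (fun a => a.2 %% n.+1 == v) es.
Proof.
rewrite degreeE -!sum1_count [X in _ = X + _]big_mkcond [X in _ = _ + X]big_mkcond.
rewrite -big_split (big_nth (0, 0)) big_mkord; apply: eq_bigr => e _.
by rewrite /inc -!val_eqE /=; do 2 case: eqP.
Qed.

Lemma simple_lgraph :
  let ends_list := [seq (a.1 %% n.+1, a.2 %% n.+1) | a <- es] in
  all (fun a => a.1 != a.2) ends_list ->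
  uniq [seq (minn a.1 a.2, maxn a.1 a.2) | a <- ends_list] ->
  simple_graph G.
Proof.
move=> el /(all_nthP (0, 0)) noloop Uel.
have szel : size el = size es by rewrite size_map.
have el_nth (e : 'I_(size es)) :
    nth (0, 0) el e = ((nth (0, 0) es e).1 %% n.+1, (nth (0, 0) es e).2 %% n.+1).
  by rewrite (nth_map (0, 0)).
split=> [e|e e' u v].
  by have := noloop e; rewrite szel el_nth -val_eqE /=; apply.
rewrite !joins_lgraph => euv e'uv; apply/val_inj/eqP.
rewrite -(nth_uniq (0, 0) _ _ Uel) ?size_map ?ltn_ord //.
rewrite !(nth_map (0, 0)) ?size_map ?ltn_ord //=.
by case/orP: euv => /andP[/eqP-> /eqP->]; case/orP: e'uv => /andP[/eqP-> /eqP->] //;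
  rewrite minnC maxnC.
Qed.

End ListGraphs.

(** * Isomorphisms *)

Lemma joins_joins (G : mgraph) (e : edge G) u v x y : joins e u v ->
  joins e x y = ((x, y) == (u, v)) || ((x, y) == (v, u)).
Proof.
case/joinsP; rewrite /joins => ->; rewrite !xpair_eqE ![x == _]eq_sym ![y == _]eq_sym.
  by rewrite [(u == y) && _]andbC.
by rewrite orbC [(v == y) && _]andbC.
Qed.

Lemma iso_sym (G H : mgraph) : iso G H -> iso H G.
Proof.
case=> f [g [[f' fK f'K] [g' gK g'K] fg]]; exists f', g'; split.
- by exists f.
- by exists g.
by move=> e u v; rewrite -fg g'K !f'K.
Qed.

Lemma iso_trans (G H K : mgraph) : iso G H -> iso H K -> iso G K.
Proof.
case=> f [g [bf bg fg]] [f' [g' [bf' bg' fg']]].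
exists (f' \o f), (g' \o g); split; try exact: bij_comp.
by move=> e u v; rewrite /= fg' fg.
Qed.

Lemma iso_card_edge (G H : mgraph) : iso G H -> #|edge G| = #|edge H|.
Proof. by case=> f [g [_ /bij_eq_card]]. Qed.

Section Iso.
Variables (G H : mgraph) (f : vert G -> vert H) (g : edge G -> edge H).
Hypothesis bij_f : bijective f.
Hypothesis bij_g : bijective g.
Hypothesis fg : forall e u v, joins (g e) (f u) (f v) = joins e u v.

Lemma iso_inc e v : inc (g e) (f v) = inc e v.
Proof.
have := joins_ends e; rewrite -fg /inc.
by case/joinsP=> -> /=; rewrite !(bij_eq bij_f) // addnC.
Qed.

Lemma iso_degree v : degree (f v) = degree v.
Proof.
rewrite !degreeE (reindex g) /=; last exact: onW_bij.
by apply: eq_bigr => e _; rewrite iso_inc.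
Qed.

Lemma iso_adj_in (S : {set edge G}) u v : adj_in (g @: S) (f u) (f v) = adj_in S u v.
Proof.
apply/adj_inP/adj_inP => [[_ /imsetP[e eS ->]]|[e eS uv]].
  by rewrite fg; exists e.
by exists (g e); rewrite ?imset_f ?fg.
Qed.

Lemma iso_adjacent u v : adjacent (f u) (f v) = adjacent u v.
Proof.
rewrite /adjacent -iso_adj_in; congr (adj_in _ _ _).
apply/esym/setP => e; rewrite inE; have [g' _ g'K] := bij_g.
by rewrite -(g'K e) imset_f.
Qed.

Lemma iso_spanning_connected (S : {set edge G}) :
  spanning_connected S -> spanning_connected (g @: S).
Proof.
move=> /spanning_connectedP cS; have [f' _ f'K] := bij_f.
apply/spanning_connectedP => a b; rewrite -(f'K a) -(f'K b).
apply: (connect_invariant (P := fun z => connect (adj_in (g @: S)) (f (f' a)) (f z)))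
  (cS (f' a) (f' b)) _ => // x y ax xy.
by apply: connect_trans ax (connect1 _); rewrite iso_adj_in.
Qed.

End Iso.

Lemma iso_nb_conn (G H : mgraph) k : iso G H -> nb_conn G k = nb_conn H k.
Proof.
suff leq_iso (G' H' : mgraph) : iso G' H' -> nb_conn G' k <= nb_conn H' k.
  by move=> GH; apply/eqP; rewrite eqn_leq !leq_iso //; apply: iso_sym.
case=> f [g [bij_f bij_g fg]].
rewrite /nb_conn -(card_imset _ (imset_inj (bij_inj bij_g))).
apply/subset_leq_card/subsetP => _ /imsetP[S + ->]; rewrite !inE => /andP[cS Sk].
by rewrite (iso_spanning_connected bij_f) //= (card_imset _ (bij_inj bij_g)).
Qed.

Lemma iso_degree_sequence (G H : mgraph) :
  iso G H -> degree_sequence G = degree_sequence H.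
Proof.
case=> f [g [bij_f bij_g fg]]; apply/perm_sortP.
- by move=> m n; apply: leq_total.
- by move=> m n p mn np; apply: leq_trans np mn.
- by move=> m n; rewrite /= -eqn_leq => /eqP.
have -> : [seq degree v | v <- enum (vert G)]
        = [seq degree v | v <- map f (enum (vert G))].
  by rewrite -map_comp; apply: eq_map => v /=; rewrite (iso_degree bij_f bij_g fg).
have [f' _ f'K] := bij_f.
apply/perm_map/uniq_perm; rewrite ?(map_inj_uniq (bij_inj bij_f)) ?enum_uniq //.
by move=> v; rewrite mem_enum -(f'K v) map_f // mem_enum.
Qed.

Lemma iso_simple (G H : mgraph) : iso G H -> simple_graph H -> simple_graph G.
Proof.
case=> f [g [bij_f bij_g fg]] [noloop nopar]; split=> [e|e e' u v].
  apply/eqP => loop; have := joins_ends e; rewrite -fg loop => gloop.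
  by have /eqP[] := noloop (g e); case/joinsP: gloop => ->.
by rewrite -!fg => ge ge'; apply: (bij_inj bij_g); apply: nopar ge ge'.
Qed.

(** Simple graphs are determined by their adjacency relation. *)
Lemma simple_iso (G H : mgraph) (f : vert G -> vert H) :
  simple_graph G -> simple_graph H -> bijective f ->
  (forall u v, adjacent (f u) (f v) = adjacent u v) -> iso G H.
Proof.
move=> [_ parG] [_ parH] bij_f adj_f.
have /fin_all_exists[g gP] (e : edge G) :
    exists e' : edge H, joins e' (f (ends e).1) (f (ends e).2).
  by apply/adjacentP; rewrite adj_f; apply/adjacentP; exists e; apply: joins_ends.
have fg e u v : joins (g e) (f u) (f v) = joins e u v.
  by rewrite (joins_joins _ _ (gP e)) (joins_joins _ _ (joins_ends e))
    !xpair_eqE !(bij_eq bij_f).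
have inj_g : injective g.
  move=> e e' ee'; apply: parG (joins_ends e) _.
  by rewrite -fg -ee' fg joins_ends.
have /fin_all_exists[g' g'K] (e' : edge H) : exists e, g e = e'.
  have [f' _ f'K] := bij_f.
  have: adjacent (f (f' (ends e').1)) (f (f' (ends e').2)).
    by rewrite !f'K; apply/adjacentP; exists e'; apply: joins_ends.
  rewrite adj_f => /adjacentP[e]; rewrite -fg !f'K => ge; exists e.
  exact: parH ge (joins_ends e').
by exists f, g; split=> //; exists g' => //; apply: inj_can_sym.
Qed.

(** In a simple graph the degree counts the neighbours. *)
Lemma simple_degree (G : mgraph) (v : vert G) :
  simple_graph G -> degree v = #|[set w | adjacent v w]|.
Proof.
move=> [noloop nopar].
rewrite degreeE -sum1dep_card [RHS]big_mkcond /=.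
have adjE w : (if adjacent v w then 1 else 0) = \sum_(e : edge G) joins e v w.
  case: ifP => [/adjacentP[e vw]|vw].
    rewrite (bigD1 e) //= vw big1 // => e' ee'; apply/eqP; rewrite eqb0.
    by apply: contra ee' => vw'; rewrite (nopar e' e v w).
  rewrite big1 // => e _; apply/eqP; rewrite eqb0; apply/negP => evw.
  by have : adjacent v w; [apply/adjacentP; exists e | rewrite vw].
under [RHS]eq_bigr do rewrite adjE.
rewrite exchange_big; apply: eq_bigr => e _ /=.
have := noloop e; rewrite /inc /joins; case: (ends e) => x y /= xy.
transitivity (\sum_w ((x == v) && (y == w) + (y == v) && (x == w))); last first.
  apply: eq_bigr => w _; rewrite !xpair_eqE.
  rewrite [(x == w) && _]andbC.
  case: (x =P v) xy => [->|] //=; case: (y =P v) => [->|] //=; rewrite ?eqxx //.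
  by rewrite addn0 orbF.
rewrite big_split /=.
have sum_and (b : bool) z : \sum_(w : vert G) b && (z == w) = b :> nat.
  rewrite (bigD1 z) //= eqxx andbT big1 ?addn0 // => w wz.
  by rewrite eq_sym (negPf wz) andbF.
by rewrite !sum_and.
Qed.

(** * The optimal graph *)

(** [K6_minus_P4_K2], with its edges listed and oriented as the edges of the
    Petersen graph of which they are images. *)
Definition opt_edges : seq (nat * nat) :=
  [:: (0, 3); (3, 4); (4, 0); (0, 5); (0, 2); (3, 1);
      (3, 5); (5, 1); (2, 5); (1, 4); (4, 2)].

Definition optG : mgraph := lgraph 5 opt_edges.

(** The vertices not adjacent to [i], other than [i]. *)
Definition nonadj (i : nat) : seq nat :=
  nth [::] [:: [:: 1]; [:: 2; 0]; [:: 3; 1]; [:: 2]; [:: 5]; [:: 4]] i.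

Lemma nb_conn_opt :
  [seq nb_conn optG (11 - k) | k <- iota 0 5] = [:: 1; 11; 55; 163; 310].
Proof. by rewrite /= !nb_conn_lgraph; vm_compute. Qed.

Lemma nb_conn_opt_tree : nb_conn optG 5 = 224.
Proof. by rewrite nb_conn_lgraph; vm_compute. Qed.

Lemma in_class_opt : in_class 6 11 optG.
Proof.
split; rewrite ?card_ord //.
have : 0 < nb_conn optG 5 by rewrite nb_conn_opt_tree.
case/card_gt0P=> S; rewrite inE => /andP[cS _].
by apply: spanning_connectedW cS; apply: subsetT.
Qed.

Lemma simple_opt : simple_graph optG.
Proof. by apply: simple_lgraph; vm_compute. Qed.

Lemma adjacent_opt (u v : 'I_6) :
  adjacent (u : vert optG) v = (u != v) && (val v \notin nonadj u).
Proof.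
rewrite adjacent_lgraph -val_eqE.
by case: u v => [[|[|[|[|[|[|//]]]]]] ?] [[|[|[|[|[|[|//]]]]]] ?]; vm_compute.
Qed.

Lemma degree_opt (v : 'I_6) :
  degree (v : vert optG) = if (val v == 1) || (val v == 2) then 3 else 4.
Proof.
rewrite degree_lgraph.
by case: v => [[|[|[|[|[|[|//]]]]]] ?]; vm_compute.
Qed.

Lemma degree_sequence_opt : degree_sequence optG = [:: 4; 4; 4; 4; 3; 3].
Proof.
rewrite /degree_sequence (eq_map degree_opt).
rewrite (map_comp (fun k => if (k == 1) || (k == 2) then 3 else 4) val).
by rewrite val_enum_ord.
Qed.

Lemma nonadjacent_opt (u v : vert optG) :
  degree u = 3 -> degree v = 3 -> ~~ adjacent u v.
Proof.
rewrite !degree_opt adjacent_opt -val_eqE.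
by case: u v => [[|[|[|[|[|[|//]]]]]] ?] [[|[|[|[|[|[|//]]]]]] ?].
Qed.

Lemma opt_iso_K6_minus_P4_K2 : iso optG K6_minus_P4_K2.
Proof.
have lt_ends (e : edge K6_minus_P4_K2) : (ends e).1 < (ends e).2.
  by case: e => a /= /andP[].
apply: (simple_iso (f := id : vert optG -> vert K6_minus_P4_K2)).
- exact: simple_opt.
- split=> [e|e e' u v euv e'uv].
    by apply: contraTneq (lt_ends e) => ->; rewrite ltnn.
  apply: val_inj; have := lt_ends e; have := lt_ends e'.
  have eV (b : edge K6_minus_P4_K2) : ends b = val b by [].
  case/joinsP: euv; case/joinsP: e'uv; rewrite !eV => -> -> //= uv vu;
    by have := ltn_trans uv vu; rewrite ltnn.
- by exists id.
move=> u v; rewrite [RHS]adjacent_opt.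
apply/adjacentP/idP => [[[[i j] ij]]|].
  rewrite /joins /= !xpair_eqE => /orP[]/andP[/eqP iu /eqP jv]; move: iu jv ij => -> -> /=;
  by case: u v => [[|[|[|[|[|[|//]]]]]] ?] [[|[|[|[|[|[|//]]]]]] ?].
have mkedge (x y : 'I_6) :
    (x < y) && ((val x, val y) \notin [:: (0, 1); (1, 2); (2, 3); (4, 5)]) ->
    exists b : edge K6_minus_P4_K2, ends b = (x, y).
  by move=> xy; exists (exist _ (x, y) xy).
move=> uv.
have : ((u < v) && ((val u, val v) \notin [:: (0, 1); (1, 2); (2, 3); (4, 5)])) ||
       ((v < u) && ((val v, val u) \notin [:: (0, 1); (1, 2); (2, 3); (4, 5)])).
  by move: uv; case: u v => [[|[|[|[|[|[|//]]]]]] ?] [[|[|[|[|[|[|//]]]]]] ?].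
by case/orP=> /mkedge[b bE]; exists b; apply/joinsP; rewrite bE; [left|right].
Qed.



(** Simple graphs on six vertices of degrees 4, 4, 4, 4, 3, 3 in which the
    vertices of degree 3 are not adjacent. *)
Definition near_regular (H : mgraph) : Prop :=
  [/\ simple_graph H, #|vert H| = 6,
      (forall v : vert H, degree v = 3 \/ degree v = 4),
      #|[set v : vert H | degree v == 3]| = 2 &
      forall u v : vert H, degree u = 3 -> degree v = 3 -> ~~ adjacent u v].

Lemma degree_sequence_near_regular (H : mgraph) :
  simple_graph H -> degree_sequence H = [:: 4; 4; 4; 4; 3; 3] ->
  (forall u v : vert H, degree u = 3 -> degree v = 3 -> ~~ adjacent u v) ->
  near_regular H.
Proof.
move=> simpleH degH nadjH.
have permH : perm_eq [seq degree v | v <- enum (vert H)] [:: 4; 4; 4; 4; 3; 3].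
  by rewrite -degH perm_sym perm_sort.
split=> //.
- by have := perm_size permH; rewrite size_map -cardE.
- move=> v; have := perm_mem permH (degree v); rewrite map_f ?mem_enum // !inE.
  by move/esym => /or4P[/eqP|/eqP|/eqP|/or3P[]/eqP]; auto.
- rewrite -[RHS]/(count (pred1 3) [:: 4; 4; 4; 4; 3; 3]) -(permP permH) count_map.
  by rewrite -sum1_count big_enum_cond -sum1dep_card; apply: eq_bigl.
Qed.

(** The nonneighbours of the vertices determine the graph: the two vertices [a]
    and [b] of degree 3 miss each other and one further vertex each, and every
    other vertex misses exactly one vertex. *)
Lemma near_regular_iso (H : mgraph) : near_regular H -> iso H optG.
Proof.
case=> simpleH card6 deg34 /eqP two3 nadj3.
(* [nn u] is the set of the nonneighbours of [u]; it has [5 - degree u] elements. *)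
pose nn (u : vert H) := [set w | (w != u) && ~~ adjacent u w].
have adjC (u v : vert H) : adjacent u v = adjacent v u by apply: adj_in_sym.
have irr (u : vert H) : ~~ adjacent u u.
  apply/adjacentP => -[e uu]; have [/(_ e) + _] := simpleH.
  by case/joinsP: uu => ->; rewrite eqxx.
have mem_nn u v : (v \in nn u) = (v != u) && ~~ adjacent u v by rewrite inE.
have nnC u v : (v \in nn u) = (u \in nn v) by rewrite !mem_nn eq_sym adjC.
have card_nn u : #|nn u| = 5 - degree u.
  have := cardsC [set w | adjacent u w]; rewrite -simple_degree // card6.
  rewrite (cardsD1 u) !inE irr add1n.
  rewrite (_ : ~: _ :\ u = nn u); first by lia.
  by apply/setP => w; rewrite !inE.
have nn4 u v : degree u = 4 -> v \in nn u -> nn u = [set v].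
  move=> du uv; apply/esym/eqP; rewrite eqEcard sub1set uv cards1 card_nn du //.
have nn3 u v w : degree u = 3 -> v \in nn u -> w \in nn u -> v != w -> nn u = [set v; w].
  move=> du uv uw vw; apply/esym/eqP.
  by rewrite eqEcard subUset !sub1set uv uw card_nn du cards2 vw.
case/cards2P: two3 => a [b [ab degab]].
have mem3 u : (degree u == 3) = (u \in [set a; b]) by rewrite -degab inE.
have da : degree a = 3 by apply/eqP; rewrite mem3 !inE eqxx.
have db : degree b = 3 by apply/eqP; rewrite mem3 !inE eqxx orbT.
have d4 u : u != a -> u != b -> degree u = 4.
  move=> ua ub; case: (deg34 u) => // /eqP; rewrite mem3 !inE.
  by rewrite (negPf ua) (negPf ub).
have ba_nn : b \in nn a by rewrite mem_nn eq_sym ab nadj3.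
have ab_nn : a \in nn b by rewrite nnC.
have other u v : degree u = 3 -> v \in nn u -> exists2 w, w \in nn u & w != v.
  move=> du uv; have : 0 < #|nn u :\ v|.
    by have := cardsD1 v (nn u); rewrite uv card_nn du; lia.
  by case/card_gt0P=> w; rewrite in_setD1 => /andP[]; exists w.
(* [x] and [y] are the further nonneighbours of [a] and [b]; they have degree 4,
   so that they miss no other vertex and are distinct. *)
have [x x_nn xb] := other _ _ da ba_nn.
have [y y_nn ya] := other _ _ db ab_nn.
have bx : b != x by rewrite eq_sym.
have nna := nn3 _ _ _ da ba_nn x_nn bx.
have nnb := nn3 _ _ _ db y_nn ab_nn ya.
have xa : x != a by move: x_nn; rewrite mem_nn => /andP[].
have yb : y != b by move: y_nn; rewrite mem_nn => /andP[].
have nnx : nn x = [set a] by apply: nn4; [apply: d4 | rewrite nnC].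
have nny : nn y = [set b] by apply: nn4; [apply: d4 | rewrite nnC].
have xy : x != y.
  apply: contra ab => /eqP xy; move: nny; rewrite -xy nnx => /setP/(_ a).
  by rewrite !inE eqxx => <-.
(* The two remaining vertices [z] and [w] can only miss each other. *)
have U4 : uniq [:: x; a; b; y].
  by rewrite /= !inE !negb_or xa xb xy ab [a == y]eq_sym ya [b == y]eq_sym yb.
have [z zN] : exists z, z \notin [:: x; a; b; y].
  apply/existsP; rewrite -negb_forall; apply: contraL isT => /forallP all4.
  have : #|vert H| <= size [:: x; a; b; y].
    by apply: leq_trans (card_size _); apply/subset_leq_card/subsetP => v _; apply: all4.
  by rewrite card6.
have [nzx nza nzb nzy] : [/\ z != x, z != a, z != b & z != y].
  by move: zN; rewrite !inE !negb_or => /and4P[].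
have dz := d4 z nza nzb.
have [w wz_nn] : exists w, w \in nn z by apply/card_gt0P; rewrite card_nn dz.
have nnz := nn4 _ _ dz wz_nn.
have wz : w != z by move: wz_nn; rewrite mem_nn => /andP[].
have zw_nn : z \in nn w by rewrite nnC.
have wa : w != a.
  by apply: contraTneq zw_nn => ->; rewrite nna !inE negb_or nzb nzx.
have wb : w != b.
  by apply: contraTneq zw_nn => ->; rewrite nnb !inE negb_or nzy nza.
have wx : w != x by apply: contraTneq zw_nn => ->; rewrite nnx inE.
have wy : w != y by apply: contraTneq zw_nn => ->; rewrite nny inE.
have nnw := nn4 _ _ (d4 w wa wb) zw_nn.
pose s := [:: x; a; b; y; z; w].
have Us : uniq s.
  move: U4; rewrite /s /= !inE !negb_or => /and4P[/and3P[-> -> ->] /andP[-> ->] -> _].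
  by rewrite ![_ == z]eq_sym ![_ == w]eq_sym nzx nza nzb nzy wx wa wb wy wz.
pose f (i : 'I_6) := nth x s i.
have inj_f : injective f.
  by move=> i j /eqP; rewrite nth_uniq // => /eqP/val_inj.
have bij_f : bijective f by apply: inj_card_bij; rewrite // card6 card_ord.
apply: iso_sym; apply: (simple_iso (f := f : vert optG -> vert H)) => //.
  exact: simple_opt.
have nn_f (i : 'I_6) : nn (f i) =i [seq nth x s k | k <- nonadj i].
  move=> v; case: i => [[|[|[|[|[|[|//]]]]]] ?]; rewrite /f /= ?nnx ?nna ?nnz ?nnw ?nny ?nnb !inE //.
move=> i j; rewrite adjacent_opt.
have -> : adjacent (f i) (f j) = (i != j) && (f j \notin nn (f i)).
  rewrite mem_nn negb_and !negbK -(inj_eq inj_f) [f j == _]eq_sym.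
  by case: eqP => [->|] //=; rewrite (negPf (irr _)).
congr (_ && ~~ _); rewrite nn_f.
apply/mapP/idP => [[k kN /eqP]|jN]; last by exists (val j).
have k6 : k < 6.
  by case: i kN => [[|[|[|[|[|[|//]]]]]] ?]; apply: (allP (a := fun k => k < 6)).
by rewrite /f nth_uniq // => /eqP jk; rewrite -[val j]/(j : nat) jk.
Qed.

(** * Edge cuts *)

Section SymmetricDifference.
Variable T : finType.
Implicit Types A B C : {set T}.

(** The symmetric difference, the sum of sets modulo 2. *)
Definition symdiff A B : {set T} := [set x | (x \in A) (+) (x \in B)].

Lemma card_symdiff A B : #|symdiff A B| + 2 * #|A :&: B| = #|A| + #|B|.
Proof.
have -> : symdiff A B = (A :\: B) :|: (B :\: A).
  by apply/setP => x; rewrite !inE; do 2 case: (x \in _).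
rewrite cardsU -(cardsID B A) -(cardsID A B) [B :&: A]setIC.
rewrite (_ : (A :\: B) :&: (B :\: A) = set0) ?cards0; first by lia.
by apply/setP => x; rewrite !inE; do 2 case: (x \in _).
Qed.

(** Two large subsets of a small set are close to each other. *)
Lemma card_symdiff_sub A B C :
  A \subset C -> B \subset C -> #|symdiff A B| + #|A| + #|B| <= 2 * #|C|.
Proof.
move=> sAC sBC; have := card_symdiff A B; have := cardsUI A B.
have : #|A :|: B| <= #|C| by rewrite subset_leq_card // subUset sAC.
lia.
Qed.

Lemma card_sum_mem A : #|A| = \sum_x (x \in A).
Proof. by rewrite -sum1_card big_mkcond. Qed.

End SymmetricDifference.

Lemma sum_eq_pointwise (I : finType) (F1 F2 : I -> nat) :
  (forall i, F1 i <= F2 i) -> \sum_i F2 i <= \sum_i F1 i ->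
  forall i, F1 i = F2 i.
Proof.
move=> le12 le21 i; apply/eqP; rewrite eqn_leq le12 /=.
move: le21; rewrite (bigD1 i) //= [leqRHS](bigD1 i) //=.
have := @leq_sum _ (index_enum I) (fun j => j != i) _ _ (fun j _ => le12 j); lia.
Qed.

Section Cuts.
Variable G : mgraph.
Implicit Types (A B : {set vert G}) (F : {set edge G}) (e : edge G) (u v w : vert G).

(** The edge boundary of a set of vertices. *)
Definition boundary A : {set edge G} :=
  [set e | ((ends e).1 \in A) (+) ((ends e).2 \in A)].

(** The boundary map is linear modulo 2. *)
Lemma boundary_symdiff A B :
  boundary (symdiff A B) = symdiff (boundary A) (boundary B).
Proof. by apply/setP => e; rewrite !inE addbACA. Qed.

(** Nonempty proper sets of vertices. *)
Definition proper_nonempty A : bool := (A != set0) && (A != setT).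

Lemma boundary_disconnects A F :
  proper_nonempty A -> boundary A \subset F -> ~~ spanning_connected (~: F).
Proof.
case/andP=> /set0Pn[x xA] AT sAF.
have [y yNA] : exists y, y \notin A.
  apply/existsP; rewrite -negb_forall; apply: contra AT => /forallP AT.
  by apply/eqP/setP => y; rewrite AT inE.
apply/negP => /spanning_connectedP/(_ x y) xy; case/negP: yNA.
apply: (connect_invariant (P := fun z => z \in A)) xy xA => a b aA.
case/adj_inP => e; rewrite inE => eNF; apply: contraLR => bNA.
have : e \notin boundary A by apply: contra eNF; apply: subsetP.
by rewrite inE; apply: contra => /joinsP[->|->] /=; rewrite aA (negPf bNA).
Qed.

Lemma nb_disc_boundary A k : proper_nonempty A -> #|boundary A| = k -> 0 < nb_disc G k.
Proof.
move=> pA Ak; apply/card_gt0P; exists (boundary A).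
by rewrite inE Ak eqxx andbT; apply: boundary_disconnects pA _.
Qed.

Lemma mem_boundary1 v e :
  (e \in boundary [set v]) = ((ends e).1 == v) (+) ((ends e).2 == v).
Proof. by rewrite !inE. Qed.

Lemma mem_boundary1_inc v e : (e \in boundary [set v]) <= inc e v.
Proof. by rewrite mem_boundary1 /inc; do 2 case: (_ == v). Qed.

Lemma card_boundary1_le v : #|boundary [set v]| <= degree v.
Proof. by rewrite degreeE card_sum_mem; apply: leq_sum => e _; apply: mem_boundary1_inc. Qed.

(** A loop contributes 2 to the degree of its vertex but not to the boundary. *)
Lemma loopless_boundary :
  (forall v, #|boundary [set v]| = degree v) -> forall e, (ends e).1 != (ends e).2.
Proof.
move=> bd_deg e; apply/eqP => loop; set v := (ends e).1.
have : (e \in boundary [set v]) = inc e v :> nat.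
  apply: (sum_eq_pointwise (mem_boundary1_inc v)).
  by rewrite -card_sum_mem -degreeE bd_deg.
by rewrite mem_boundary1 /inc -loop eqxx.
Qed.

Lemma joins_boundary u v e : u != v -> joins e u v ->
  e \in boundary [set u] :&: boundary [set v].
Proof.
move=> uv euv; rewrite in_setI !mem_boundary1.
by case/joinsP: euv => -> /=; rewrite !eqxx [v == u]eq_sym (negPf uv).
Qed.

End Cuts.

(** * Deleting three or four edges *)

Section SixEleven.
Variable H : mgraph.
Hypothesis classH : in_class 6 11 H.
Implicit Types (A : {set vert H}) (F : {set edge H}) (u v w : vert H).

Local Notation c v := #|boundary [set v]|.

Lemma proper_small A : 0 < #|A| < 6 -> proper_nonempty A.
Proof.
have [_ card6 _] := classH => /andP[A0 A6]; rewrite /proper_nonempty -card_gt0 A0.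
by apply: contraTneq A6 => ->; rewrite cardsT card6.
Qed.

(** From here on no deletion of at most two edges disconnects the graph. *)
Hypothesis disc1 : nb_disc H 1 = 0.
Hypothesis disc2 : nb_disc H 2 = 0.

Lemma boundary_ge3 A : 0 < #|A| < 6 -> 2 < #|boundary A|.
Proof.
move=> A6; have pA := proper_small A6; case bdA: #|boundary A| => [|[|[|k]]] //.
- have [cH _ _] := classH.
  have := boundary_disconnects pA (subxx _).
  by rewrite (cards0_eq bdA) setC0 -[spanning_connected _]/(connected_graph H) cH.
- by have := nb_disc_boundary pA bdA; rewrite disc1.
- by have := nb_disc_boundary pA bdA; rewrite disc2.
Qed.

Lemma card_symdiff12 u v w :
  u != v -> 0 < #|symdiff [set u; v] [set w]| < 6.
Proof.
move=> uv; have := card_symdiff [set u; v] [set w]; rewrite cards1 cards2 uv.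
have := subset_leq_card (subsetIr [set u; v] [set w]); rewrite cards1; lia.
Qed.

Lemma card_symdiff11 u v : u != v -> 0 < #|symdiff [set u] [set v]| < 6.
Proof.
move=> uv; have := card_symdiff [set u] [set v]; rewrite !cards1.
have -> : [set u] :&: [set v] = set0; last by rewrite cards0; lia.
by apply/setP => x; rewrite !inE; case: eqP => // ->; rewrite (negPf uv).
Qed.

(** The boundaries of two vertices differ in at least three edges, because their
    symmetric difference is the boundary of the pair. *)
Lemma stars_apart u v F : u != v ->
  boundary [set u] \subset F -> boundary [set v] \subset F -> c u + c v + 2 < 2 * #|F|.
Proof.
move=> uv uF vF; have := card_symdiff_sub uF vF.
rewrite -boundary_symdiff; have := boundary_ge3 (card_symdiff11 uv); lia.
Qed.

(** Likewise for the boundaries of a pair and of a vertex, whose symmetric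
    difference is the boundary of one or three vertices. *)
Lemma star_pair_apart u v w : u != v ->
  boundary [set w] \subset boundary [set u; v] -> c w + 2 < #|boundary [set u; v]|.
Proof.
move=> uv wuv; have := card_symdiff_sub (subxx _) wuv.
rewrite -boundary_symdiff; have := boundary_ge3 (card_symdiff12 w uv); lia.
Qed.

Lemma c_ge3 v : 2 < c v.
Proof. by apply: boundary_ge3; rewrite cards1. Qed.

(** The vertices whose boundary has three edges. *)
Definition stars3 := [set v : vert H | c v == 3].

Lemma sum_degree22 : \sum_(v : vert H) degree v = 22.
Proof. by have [_ _ card11] := classH; rewrite handshake card11. Qed.

Lemma sum_le22 : \sum_(v : vert H) c v <= 22.
Proof. by rewrite -sum_degree22; apply: leq_sum => v _; apply: card_boundary1_le. Qed.

Lemma sum_four : \sum_(v : vert H) (c v + (v \in stars3)) = \sum_(v : vert H) c v + #|stars3|.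
Proof. by rewrite big_split -card_sum_mem. Qed.

Lemma c_ge4 v : 4 <= c v + (v \in stars3).
Proof. by rewrite inE; have := c_ge3 v; case: eqP; lia. Qed.

Lemma sum4 : \sum_(v : vert H) 4 = 24.
Proof. by have [_ card6 _] := classH; rewrite sum_nat_const card6. Qed.

(** Otherwise the boundaries of the vertices would have total size above 22. *)
Lemma stars3_ge2 : 1 < #|stars3|.
Proof.
have : \sum_(v : vert H) 4 <= \sum_(v : vert H) (c v + (v \in stars3)).
  by apply: leq_sum => v _; apply: c_ge4.
by rewrite sum4 sum_four; have := sum_le22; lia.
Qed.

Lemma star3_disc v : v \in stars3 ->
  boundary [set v] \in [set F | ~~ spanning_connected (~: F) & #|F| == 3].
Proof.
rewrite !inE => ->; rewrite andbT; apply: boundary_disconnects (subxx _).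
by apply: proper_small; rewrite cards1.
Qed.

Lemma star_inj : injective (fun v : vert H => boundary [set v]).
Proof.
move=> u v uv; apply/eqP; apply: contraT => /stars_apart/(_ (subxx _)).
by rewrite -uv => /(_ (subxx _)); lia.
Qed.

Lemma stars3_disc3 : #|stars3| <= nb_disc H 3.
Proof.
rewrite -(card_imset _ star_inj); apply/subset_leq_card/subsetP.
by move=> _ /imsetP[v v3 ->]; apply: star3_disc.
Qed.

(** From here on at most two deletions of three edges disconnect the graph:
    these are the deletions of the boundaries of the vertices in [stars3]. *)
Hypothesis disc3 : nb_disc H 3 <= 2.

Lemma stars3_eq2 : #|stars3| = 2.
Proof. by have := stars3_ge2; have := stars3_disc3; lia. Qed.

Lemma disc3_star F : ~~ spanning_connected (~: F) -> #|F| = 3 ->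
  exists2 v, v \in stars3 & F = boundary [set v].
Proof.
move=> dF F3.
have sub : [set boundary [set v] | v in stars3]
    \subset [set F' : {set edge H} | ~~ spanning_connected (~: F') & #|F'| == 3].
  by apply/subsetP => _ /imsetP[v v3 ->]; apply: star3_disc.
have /eqP eq3 : [set boundary [set v] | v in stars3]
    == [set F' : {set edge H} | ~~ spanning_connected (~: F') & #|F'| == 3].
  rewrite eqEcard sub (card_imset _ star_inj) stars3_eq2; exact: disc3.
have : F \in [set boundary [set v] | v in stars3].
  by rewrite eq3 inE dF F3.
by case/imsetP=> v; exists v.
Qed.

Lemma c_eq v : c v = if v \in stars3 then 3 else 4.
Proof.
have : 4 = c v + (v \in stars3).
  apply: (sum_eq_pointwise c_ge4).
  by rewrite sum4 sum_four stars3_eq2; have := sum_le22; lia.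
by case: ifP => _ /=; lia.
Qed.

Lemma c_degree v : c v = degree v.
Proof.
apply: (sum_eq_pointwise (@card_boundary1_le H)).
have := sum_four; rewrite stars3_eq2 sum_degree22.
have : \sum_(v : vert H) 4 <= \sum_(v : vert H) (c v + (v \in stars3)).
  by apply: leq_sum => w _; apply: c_ge4.
rewrite sum4; lia.
Qed.

(** The four-edge sets whose deletion isolates [v]. *)
Definition isolating v := [set F : {set edge H} | boundary [set v] \subset F & #|F| == 4].

Lemma card_isolating v : (if v \in stars3 then 8 else 1) <= #|isolating v|.
Proof.
have cv := c_eq v; case: ifP cv => v3 cv; last first.
  by apply/card_gt0P; exists (boundary [set v]); rewrite inE subxx cv.
have [_ _ card11] := classH.
have -> : 8 = #|~: boundary [set v]| by have := cardsC (boundary [set v]); lia.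
have inj_add : {in ~: boundary [set v] &, injective (fun e => e |: boundary [set v])}.
  move=> e f; rewrite !inE -!mem_boundary1 => eN fN ef.
  have : e \in f |: boundary [set v] by rewrite -ef setU11.
  by rewrite in_setU1 (negPf eN) orbF => /eqP.
rewrite -(card_in_imset inj_add); apply/subset_leq_card/subsetP => _ /imsetP[e eN ->].
by rewrite inE subsetUr cardsU1 -in_setC eN cv.
Qed.

Lemma isolating_disjoint u v : u != v -> [disjoint isolating u & isolating v].
Proof.
move=> uv; apply/pred0P => F /=; rewrite !inE.
apply/negP => /andP[/andP[uF /eqP F4] /andP[vF _]].
by have := stars_apart uv uF vF; have := c_ge3 u; have := c_ge3 v; lia.
Qed.

(** Two vertices contribute 8 sets each, the other four one each. *)
Lemma card_isolating_cover : 20 <= #|\bigcup_v isolating v|.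
Proof.
rewrite -sum1_card (partition_disjoint_bigcup _ _ isolating_disjoint).
have : \sum_v (if v \in stars3 then 8 else 1) <= \sum_v #|isolating v|.
  by apply: leq_sum => v _; apply: card_isolating.
under [leqRHS]eq_bigr do rewrite -sum1_card.
apply: leq_trans.
rewrite (eq_bigr (fun v => 1 + 7 * (v \in stars3))) => [|v _]; last by case: ifP.
have [_ card6 _] := classH.
by rewrite big_split -big_distrr /= -card_sum_mem stars3_eq2 sum_nat_const card6.
Qed.

Lemma isolating_cover_disc :
  \bigcup_v isolating v \subset [set F : {set edge H} | ~~ spanning_connected (~: F) & #|F| == 4].
Proof.
apply/bigcupsP => v _; apply/subsetP => F; rewrite !inE => /andP[vF ->]; rewrite andbT.
by apply: boundary_disconnects vF; apply: proper_small; rewrite cards1.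
Qed.

(** From here on every disconnecting deletion of four edges isolates a vertex. *)
Hypothesis disc4 : nb_disc H 4 <= 20.

Lemma disc4_isolating F : ~~ spanning_connected (~: F) -> #|F| = 4 ->
  exists v, boundary [set v] \subset F.
Proof.
move=> dF F4; have : F \in \bigcup_v isolating v.
  have /eqP-> : \bigcup_v isolating v
      == [set F : {set edge H} | ~~ spanning_connected (~: F) & #|F| == 4].
    by rewrite eqEcard isolating_cover_disc (leq_trans disc4 card_isolating_cover).
  by rewrite inE dF F4.
by case/bigcupP=> v _; rewrite inE => /andP[vF _]; exists v.
Qed.

(** A boundary of size 3 or 4 contains the boundary of a vertex, to which the
    boundary of a pair is never close enough. *)
Lemma boundary_pair_ge5 u v : u != v -> 4 < #|boundary [set u; v]|.
Proof.
move=> uv; have card2 : 0 < #|[set u; v]| < 6 by rewrite cards2 uv.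
have dF := boundary_disconnects (proper_small card2) (subxx _).
have := boundary_ge3 card2; case bd: #|_| => [|[|[|[|[|k]]]]] // _.
- have [w _ bdw] := disc3_star dF bd.
  by have := star_pair_apart (w := w) uv; rewrite bdw subxx => /(_ isT); lia.
- have [w bdw] := disc4_isolating dF bd.
  by have := star_pair_apart uv bdw; have := c_ge3 w; lia.
Qed.

(** As the boundary of a pair has at least five edges, two vertices are joined by
    at most one edge, and by none if both have degree 3. *)
Lemma boundary_meet u v : u != v ->
  #|boundary [set u] :&: boundary [set v]| <= (degree u != 3) || (degree v != 3).
Proof.
move=> uv; have := card_symdiff (boundary [set u]) (boundary [set v]).
rewrite -boundary_symdiff (_ : symdiff [set u] [set v] = [set u; v]); last first.
  by apply/setP => x; rewrite !inE; case: eqP => // ->; rewrite (negPf uv).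
have := boundary_pair_ge5 uv; rewrite -!c_degree.
rewrite !c_eq; do 2 case: ifP => _ /=; lia.
Qed.

Lemma near_regular_of_disc : near_regular H.
Proof.
have [_ card6 _] := classH.
have noloop : forall e : edge H, (ends e).1 != (ends e).2.
  exact: loopless_boundary c_degree.
have neq_ends (e : edge H) (u v : vert H) : joins e u v -> u != v.
  by case/joinsP=> eE; have := noloop e; rewrite eE // eq_sym.
split=> //.
- split=> // e e' u v euv e'uv; have uv := neq_ends e u v euv.
  have : #|boundary [set u] :&: boundary [set v]| <= 1.
    by apply: leq_trans (boundary_meet uv) _; case: (_ || _).
  by move/card_le1_eqP; apply; apply: joins_boundary.
- by move=> v; rewrite -c_degree c_eq; case: ifP; auto.
- rewrite -[RHS]stars3_eq2; apply: eq_card => v; rewrite !inE.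
  by rewrite c_degree.
move=> u v du dv; apply/adjacentP => -[e euv]; have uv := neq_ends e u v euv.
have := boundary_meet uv; rewrite du dv /= leqn0 cards_eq0 => /eqP/setP/(_ e).
by rewrite joins_boundary // inE.
Qed.

End SixEleven.

(** The optimal graph has 0, 0, 2 and 20 disconnecting sets of 1, 2, 3 and 4
    edges; a graph of the class that is not near-regular is lexicographically
    above. *)
Lemma disc_lex_or_near_regular (H : mgraph) : in_class 6 11 H ->
  [\/ 0 < nb_disc H 1, 0 < nb_disc H 2, 2 < nb_disc H 3 |
      1 < nb_disc H 3 /\ 20 < nb_disc H 4] \/ near_regular H.
Proof.
move=> classH.
have [d1|] := posnP (nb_disc H 1); last by left; apply: Or41.
have [d2|] := posnP (nb_disc H 2); last by left; apply: Or42.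
have [d3|] := leqP (nb_disc H 3) 2; last by left; apply: Or43.
have [d4|] := leqP (nb_disc H 4) 20; first by right; apply: near_regular_of_disc.
left; apply: Or44; split=> //.
exact: leq_trans (stars3_ge2 classH d1 d2) (stars3_disc3 classH d1 d2).
Qed.

(** * Reliability near the ends of the unit interval *)

Section Lexicographic.
Variable R : realFieldType.
Local Open Scope ring_scope.

Lemma bernoulli_le (q : R) n : 0 <= q <= 1 -> 1 - n%:R * q <= (1 - q) ^+ n.
Proof.
case/andP=> q0 q1; elim: n => [|n IHn]; first by rewrite mul0r subr0 expr0.
rewrite exprSr; apply: (@le_trans _ _ ((1 - n%:R * q) * (1 - q))); last first.
  by rewrite ler_wpM2r // subr_ge0.
rewrite -natr1; have : 0 <= n%:R * (q * q) by rewrite !mulr_ge0.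
by lra.
Qed.

(** For small [q], the first index at which the coefficients differ decides
    which of the two sums is larger. *)
Lemma lex_ltr (m M k : nat) (a b : nat -> nat) (q : R) :
  (k <= m)%N -> (forall j, (j < k)%N -> (b j <= a j)%N) -> (b k < a k)%N ->
  (\sum_(j < m.+1) b j <= M)%N -> 0 < q -> q * (m + M).+1%:R <= 1 ->
  \sum_(j < m.+1) (b j)%:R * (q ^+ j * (1 - q) ^+ (m - j)) <
  \sum_(j < m.+1) (a j)%:R * (q ^+ j * (1 - q) ^+ (m - j)).
Proof.
move=> km ba bak bM q0 qM.
have q1 : q <= 1.
  by apply: le_trans qM; rewrite ler_pMr // ler1n.
have q_ge0 := ltW q0.
have p0 : 0 <= 1 - q by rewrite subr_ge0.
have p1 : 1 - q <= 1 by rewrite gerBl.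
set t := fun j : nat => q ^+ j * (1 - q) ^+ (m - j).
have t_ge0 j : 0 <= t j by rewrite mulr_ge0 ?exprn_ge0.
have bound (j : 'I_m.+1) : (b j)%:R * t j
    <= (a j)%:R * t j - (j == inord k)%:R * (q ^+ k * (1 - q) ^+ m)
       + (b j)%:R * q ^+ k.+1.
  (* Each term is compared on its own: terms below [k] by hypothesis, the term [k]
     gains at least [q ^+ k * (1 - q) ^+ m], and later ones are at most
     [(b j)%:R * q ^+ k.+1]. *)
  have b_ge0 : 0 <= (b j)%:R * q ^+ k.+1 by rewrite mulr_ge0 ?exprn_ge0 ?ler0n.
  rewrite -val_eqE /= inordK //.
  have [jk|kj|jk] := ltngtP j k.
  - rewrite mul0r subr0 -[leLHS]addr0 lerD //.
    by rewrite ler_wpM2r // ler_nat ba.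
  - rewrite mul0r subr0 -[leLHS]add0r; apply: lerD.
      by rewrite mulr_ge0 ?ler0n.
    rewrite ler_wpM2l ?ler0n // -[leRHS]mulr1 ler_pM ?exprn_ge0 ?ler0n //.
      by rewrite ler_wiXn2l.
    by rewrite exprn_ile1.
  - rewrite jk in b_ge0 *; rewrite mul1r -[leLHS]addr0 lerD // lerBrDr.
    apply: (@le_trans _ _ ((b k)%:R * t k + t k)).
      by rewrite lerD2l ler_wpM2l ?exprn_ge0 ?ler0n // ler_wiXn2l // leq_subr.
    by rewrite -[X in _ + X]mul1r -mulrDl ler_wpM2r // natr1 ler_nat.
apply: le_lt_trans (ler_sum _ (fun j _ => bound j)) _.
rewrite big_split /= sumrB -!mulr_suml.
have -> : \sum_(j < m.+1) (j == inord k)%:R = 1 :> R.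
  by rewrite (bigD1 (inord k)) //= eqxx big1 ?addr0 // => j /negPf->.
rewrite -natr_sum mul1r -addrA gtrDl addrC subr_lt0 exprSr mulrCA ltr_pM2l ?exprn_gt0 //.
apply: (@le_lt_trans _ _ (M%:R * q)); first by rewrite ler_wpM2r ?ler_nat.
apply: lt_le_trans (bernoulli_le m _); last by rewrite q_ge0.
by move: qM; rewrite -natr1 natrD; lra.
Qed.

End Lexicographic.

Section Reliability.
Variable R : realType.
Local Open Scope ring_scope.

(** The reliability polynomial, by the number of retained edges. *)
Lemma reliabilityE (G : mgraph) (p : R) :
  reliability G p = \sum_(k < #|edge G|.+1)
    (nb_conn G k)%:R * (p ^+ k * (1 - p) ^+ (#|edge G| - k)).
Proof.
have weight (S : {set edge G}) : \prod_(e : edge G) (if e \in S then p else 1 - p)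
    = p ^+ #|S| * (1 - p) ^+ (#|edge G| - #|S|).
  rewrite (bigID (mem S)) /=; congr (_ * _).
    by rewrite (eq_bigr (fun _ => p)) ?prodr_const // => e ->.
  rewrite (eq_bigr (fun _ => 1 - p)) => [|e /negPf-> //].
  rewrite (eq_bigl (mem (~: S))) => [|e]; last by rewrite !inE.
  by rewrite prodr_const [#|_|]cardsCs setCK.
have leS (S : {set edge G}) : (#|S| < #|edge G|.+1)%N by rewrite ltnS max_card.
rewrite /reliability (partition_big (fun S : {set edge G} => inord #|S| : 'I_#|edge G|.+1) predT) //=.
apply: eq_bigr => k _; rewrite mulr_natl -sumr_const.
apply: eq_big => S; rewrite ?inE -val_eqE /= inordK // => /andP[_ /eqP <-].
exact: weight.
Qed.

(** A bound on how small [1 - p], or [p], must be for the comparison of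
    coefficients to decide the comparison of reliabilities. *)
Definition threshold (m : nat) : R :=
  ((m + \sum_(k < m.+1) 'C(m, k)).+1%:R)^-1.

Lemma threshold_gt0 m : 0 < threshold m.
Proof. by rewrite invr_gt0 ltr0n. Qed.

Lemma threshold_lt1 m : threshold m < 1.
Proof.
rewrite invf_lt1 ?ltr0n // ltr1n ltnS addn_gt0 big_ord_recl /= bin0.
by rewrite orbT.
Qed.

Lemma nb_conn_le_bin (G : mgraph) m k :
  #|edge G| = m -> (nb_conn G k <= 'C(m, k))%N.
Proof.
move=> <-; rewrite -card_draws; apply/subset_leq_card/subsetP => S.
by rewrite !inE => /andP[].
Qed.

Lemma reliability_lt_small (G H : mgraph) (k : nat) (p : R) :
  #|edge G| = #|edge H| -> (k <= #|edge G|)%N ->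
  (forall j, (j < k)%N -> (nb_conn H j <= nb_conn G j)%N) ->
  (nb_conn H k < nb_conn G k)%N ->
  0 < p < threshold #|edge G| -> reliability H p < reliability G p.
Proof.
move=> mGH km le_j lt_k /andP[p0 pt]; rewrite !reliabilityE -mGH.
apply: (lex_ltr (M := \sum_(j < #|edge G|.+1) 'C(#|edge G|, j)) km le_j lt_k _ p0).
  by rewrite leq_sum // => j _; apply: nb_conn_le_bin.
by rewrite -ler_pdivlMr ?ltr0n // div1r ltW.
Qed.

Lemma reliability_lt_large (G H : mgraph) (k : nat) (p : R) (m := #|edge G|) :
  #|edge G| = #|edge H| -> (k <= m)%N ->
  (forall j, (j < k)%N -> (nb_conn H (m - j) <= nb_conn G (m - j))%N) ->
  (nb_conn H (m - k) < nb_conn G (m - k))%N ->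
  1 - threshold m < p < 1 -> reliability H p < reliability G p.
Proof.
move=> mGH km le_j lt_k /andP[pt p1]; rewrite !reliabilityE -mGH -/m.
have rev (K : mgraph) : \sum_(k < m.+1) (nb_conn K k)%:R * (p ^+ k * (1 - p) ^+ (m - k))
    = \sum_(k < m.+1) (nb_conn K (m - k))%:R * ((1 - p) ^+ k * (1 - (1 - p)) ^+ (m - k)).
  rewrite (reindex_inj rev_ord_inj) /=; apply: eq_bigr => j _.
  rewrite subSS subKn ?(leq_ord j) // (_ : 1 - (1 - p) = p); last by lra.
  by rewrite [_ ^+ j * _]mulrC.
rewrite !rev.
apply: (lex_ltr (M := \sum_(j < m.+1) 'C(m, j)) km le_j lt_k).
- by rewrite leq_sum // => j _; rewrite -(bin_sub (leq_ord j)); apply: nb_conn_le_bin.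
- by rewrite subr_gt0.
rewrite -ler_pdivlMr ?ltr0n // div1r ltW //.
by rewrite ltrBlDr addrC -ltrBlDr.
Qed.

Lemma iso_reliability (G H : mgraph) (p : R) :
  iso G H -> reliability G p = reliability H p.
Proof.
move=> GH; rewrite !reliabilityE (iso_card_edge GH).
by apply: eq_bigr => k _; rewrite (iso_nb_conn _ GH).
Qed.

End Reliability.

(** * Contractions of matchings in the Petersen graph *)

(** If every weight is 0 or 1, as the hypotheses on [h] imply, the weak
    subdivision is the contraction of the edges of weight 0: [c] sends a vertex
    to its class, [r] picks a representative, and [h] embeds the edges of the
    contraction. *)
Lemma contraction_iso (D H : mgraph) (l : edge D -> nat)
    (c : vert D -> vert H) (r : vert H -> vert D) (h : edge H -> edge D) :
  cancel r c ->
  (forall e, l e = 0 -> c (ends e).1 = c (ends e).2) ->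
  (forall x, connect (adj_in [set e | l e == 0]) (r (c x)) x) ->
  injective h -> (forall a, l (h a) = 1) ->
  (forall e, l e != 0 -> exists a, h a = e) ->
  (forall a, ends a = (c (ends (h a)).1, c (ends (h a)).2)) ->
  iso H (wsub l).
Proof.
move=> rK c0 connr inj_h lh hsurj endsH.
have cP x y : connect (adj_in [set e | l e == 0]) x y = (c x == c y).
  apply/idP/eqP => [xy|cxy].
    apply/eqP; apply: (connect_invariant (P := fun z => c x == c z)) xy _ => //.
    move=> a b /eqP-> /adj_inP[e]; rewrite inE => /eqP /c0 ce.
    by case/joinsP=> eE; move: ce; rewrite eE /= => ->.
  apply: connect_trans (connr y); rewrite -cxy connect_adjC; exact: connr.
have contractE x y : (contract l x == contract l y) = (c x == c y).
  rewrite -val_eqE /= /zero_class -cP; apply/eqP/idP => [/setP/(_ y)|xy].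
    by rewrite !inE connect0.
  apply/setP => z; rewrite !inE !cP; congr (_ == _).
  by apply/eqP; rewrite -cP.
have contractr x : contract l (r (c x)) = contract l x.
  by apply/eqP; rewrite contractE rK.
pose f w : vert (wsub l) := inl (contract l (r w)).
have inj_f : injective f.
  by move=> w w' [] /eqP; rewrite -val_eqE /= -[_ == _]/(contract l _ == contract l _)
       contractE !rK => /eqP.
have l1 e : l e <= 1.
  by case: (posnP (l e)) => [->//|]; rewrite lt0n => /hsurj[a <-]; rewrite lh.
have surj_f (w' : vert (wsub l)) : exists w, f w = w'.
  case: w' => [[B BP]|[e i]].
    have /codomP[x Bx] := BP; exists (c x); congr inl.
    by apply: val_inj; rewrite contractr /= Bx.
  by have := leq_ltn_trans (leq0n _) (ltn_ord i); have := l1 e; lia.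
have lh0 a : 0 < l (h a) by rewrite lh.
pose g a : edge (wsub l) := Tagged (fun e => 'I_(l e)) (Ordinal (lh0 a)).
have inj_g : injective g by move=> a b /(congr1 tag) /inj_h.
have surj_g (b : edge (wsub l)) : exists a, g a = b.
  case: b => e i; have /hsurj[a ae] : l e != 0.
    by have := leq_ltn_trans (leq0n _) (ltn_ord i); lia.
  case: e / ae i => i; exists a; congr Tagged; apply: val_inj => /=.
  by case: i => i /=; rewrite lh; case: i.
have ends_g a : ends (g a) = (f (ends a).1, f (ends a).2).
  rewrite endsH /= /wsub_ends /path_vertex /f /= !contractr.
  case: insubP => //= i _ _; have := leq_ltn_trans (leq0n _) (ltn_ord i).
  by have := l1 (h a); lia.
have [f' f'K] := fin_all_exists surj_f.
have [g' g'K] := fin_all_exists surj_g.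
exists f, g; split.
- by exists f' => //; apply: inj_can_sym.
- by exists g' => //; apply: inj_can_sym.
move=> a u v; rewrite /joins ends_g [ends a]surjective_pairing.
by rewrite !xpair_eqE !(inj_eq inj_f).
Qed.

(** If the edges of weight 0 form a matching, every cycle has positive weight,
    because it has two edges at each of its vertices. *)
Lemma matching_cycle_pos (D : mgraph) (l : edge D -> nat) :
  (forall v, \sum_(e | l e == 0) inc e v <= 1) ->
  forall C : {set edge D}, is_cycle C -> 0 < \sum_(e in C) l e.
Proof.
move=> matching C /and3P[/set0Pn[e eC] /forallP/(_ (ends e).1) degC _].
rewrite lt0n sum_nat_eq0; apply/negP => /forall_inP C0.
have : deg_in C (ends e).1 <= 1.
  apply: leq_trans (matching (ends e).1); rewrite deg_inE.
  rewrite [leqRHS](bigID (mem C)) /= (eq_bigl (fun e => (l e == 0) && (e \in C))).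
    exact: leq_addr.
  by move=> e' /=; case e'C: (e' \in C); rewrite ?andbF // C0.
have : 0 < deg_in C (ends e).1 by rewrite deg_inE (bigD1 e) //= /inc eqxx.
by move: degC; rewrite !inE => /orP[]/eqP->.
Qed.

(** The vertices are numbered from 0 to 9, the outer ones before the inner ones. *)
Definition petersen_vertex (k : nat) : vert petersen :=
  if k < 5 then inl (inZp k) else inr (inZp (k - 5)).

(** The edges are numbered from 0 to 14: rim, spokes, inner edges. *)
Definition petersen_edge (k : nat) : edge petersen :=
  if k < 5 then inl (inl (inZp k))
  else if k < 10 then inl (inr (inZp (k - 5))) else inr (inZp (k - 10)).

(** The index of a vertex, inverse to [petersen_vertex] on [0, ..., 9]. *)
Definition petersen_index (x : vert petersen) : nat :=
  match x with inl i => i | inr i => i + 5 end.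

Lemma petersen_all_vertices (Q : pred (vert petersen)) :
  all Q (map petersen_vertex (iota 0 10)) -> forall x, Q x.
Proof.
move=> /allP allQ x; apply/allQ/mapP; exists (petersen_index x).
  by rewrite mem_iota; case: x => -[i i5] /=; lia.
apply/eqP; case: x => -[i i5] /=; rewrite /petersen_vertex.
  by rewrite i5; apply/eqP; congr inl; apply: val_inj; rewrite /= modn_small.
by rewrite ifF; [apply/eqP; congr inr; apply: val_inj; rewrite /= addnK modn_small | lia].
Qed.

Lemma petersen_all_edges (Q : pred (edge petersen)) :
  all Q (map petersen_edge (iota 0 15)) -> forall e, Q e.
Proof.
move=> /allP allQ [[i|i]|i]; apply/allQ/mapP.
- exists (i : nat); first by rewrite mem_iota; case: i => i /=; lia.
  by rewrite /petersen_edge ltn_ord; do 2 congr inl; rewrite valZpK.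
- exists (i + 5); first by rewrite mem_iota; case: i => i /=; lia.
  rewrite /petersen_edge ifF ?ifT; try by case: i => i /=; lia.
  by congr (inl (inr _)); rewrite addnK valZpK.
- exists (i + 10); first by rewrite mem_iota; case: i => i /=; lia.
  rewrite /petersen_edge !ifF; try by case: i => i /=; lia.
  by congr inr; rewrite addnK valZpK.
Qed.

Lemma petersen_connected : connected_graph petersen.
Proof.
set S : {set edge petersen} := setT.
have step e : connect (adj_in S) (ends e).1 (ends e).2 by apply: connect_ends; rewrite inE.
have rim (i : 'I_5) : connect (adj_in S) (inl ord0) (inl i).
  case: i => i; elim: i => [|i IHi] i5.
    by rewrite (_ : Ordinal _ = ord0) ?connect0 //; apply: val_inj.
  apply: connect_trans (IHi (ltnW i5)) _.
  have := step (inl (inl (Ordinal (ltnW i5)))); rewrite /=.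
  rewrite (_ : (_ + 1)%R = Ordinal i5) //; apply: val_inj => /=.
  by rewrite !modn_small // addn1.
have root x : connect (adj_in S) (inl ord0) x.
  case: x => i; first exact: rim.
  by apply: connect_trans (rim i) _; apply: (step (inl (inr i))).
apply/spanning_connectedP => x y; apply: connect_trans (root y).
by rewrite connect_adjC.
Qed.

Lemma petersen_cubic : cubic petersen.
Proof.
pose es := map petersen_edge (iota 0 15).
have degE (x : vert petersen) : degree x = sumn [seq inc e x | e <- es].
  rewrite degreeE sumnE big_map [RHS]big_uniq //=; apply: eq_bigl => e.
  by apply/esym/(petersen_all_edges (Q := mem es))/allP.
apply/forallP => x; rewrite degE.
by apply: (petersen_all_vertices (Q := fun x => sumn [seq inc e x | e <- es] == 3)).
Qed.

(** [zs] lists the contracted edges and [hs] the remaining ones, in the order of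
    [es]; [cs] lists the classes of the ten vertices, and [rs] a representative
    of each of the six classes. *)
Section PetersenContraction.
Variables (es : seq (nat * nat)) (zs hs cs rs : seq nat).

Let Z := map petersen_edge zs.
Let l (e : edge petersen) : nat := e \notin Z.
Let c (x : vert petersen) : 'I_6 := inZp (nth 0 cs (petersen_index x)).
Let r (k : 'I_6) := petersen_vertex (nth 0 rs k).

(** All hypotheses are decided by evaluation; the last one says that the
    contracted edges form a matching. *)
Lemma petersen_contraction :
  all (fun k => c (r (inZp k)) == inZp k) (iota 0 6) ->
  all (fun e => c (ends e).1 == c (ends e).2) Z ->
  all (fun x => (r (c x) == x) || has (fun e => joins e (r (c x)) x) Z)
    (map petersen_vertex (iota 0 10)) ->
  uniq (map petersen_edge hs) ->
  all (fun e => (e \in Z) || (e \in map petersen_edge hs)) 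
    (map petersen_edge (iota 0 15)) ->
  all (fun e => e \notin Z) (map petersen_edge hs) ->
  es = [seq (val (c (ends e).1), val (c (ends e).2)) | e <- map petersen_edge hs] ->
  uniq Z ->
  all (fun x => sumn [seq inc e x | e <- Z] <= 1)
    (map petersen_vertex (iota 0 10)) ->
  weak_subdivision petersen (lgraph 5 es).
Proof.
move=> rK cZ conn Uh hsurj hZ esE UZ matching.
split; [exact: petersen_connected | exact: petersen_cubic | exists l; split].
  apply: matching_cycle_pos => x.
  apply: leq_trans (petersen_all_vertices matching x).
  rewrite sumnE big_map big_uniq //=.
  by rewrite (eq_bigl (mem Z)) // => e; rewrite eqb0 negbK.
have l0 e : (l e == 0) = (e \in Z) by rewrite eqb0 negbK.
have sz : size es = size (map petersen_edge hs) by rewrite esE size_map.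
pose h (a : 'I_(size es)) := nth (petersen_edge 0) (map petersen_edge hs) a.
apply: (@contraction_iso petersen (lgraph 5 es) l c r h).
- move=> k; have /allP/(_ (val k)) := rK; rewrite mem_iota ltn_ord valZpK.
  by move=> /(_ isT)/eqP.
- by move=> e /eqP; rewrite l0 => eZ; apply/eqP/(allP cZ).
- move=> x; have /orP[/eqP->|/hasP[e eZ ex]] := petersen_all_vertices conn x.
    exact: connect0.
  by apply/connect1/adj_inP; exists e; rewrite ?inE ?l0.
- by move=> a b /eqP; rewrite nth_uniq -?sz // => /eqP/val_inj.
- by move=> a; rewrite /l (allP hZ) // mem_nth -?sz.
- move=> e; rewrite l0 => eNZ; have := petersen_all_edges hsurj e.
  rewrite (negPf eNZ) => /(nthP (petersen_edge 0))[k]; rewrite -sz => kes <-.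
  by exists (Ordinal kes).
have nth_es k : k < size es ->
    nth (0, 0) es k = let e := nth (petersen_edge 0) (map petersen_edge hs) k in
                      (val (c (ends e).1), val (c (ends e).2)).
  by move=> kes; rewrite {1}esE (nth_map (petersen_edge 0)) -?sz.
by move=> a; rewrite /= nth_es // !valZpK.
Qed.

End PetersenContraction.

(** [optG] contracts the rim edges 0 and 2, the spoke 4 and the inner edge 3. *)
Lemma weak_subdivision_opt : weak_subdivision petersen optG.
Proof.
apply: (@petersen_contraction opt_edges [:: 0; 2; 9; 13]
  [:: 1; 3; 4; 5; 6; 7; 8; 10; 11; 12; 14] [:: 0; 0; 3; 3; 4; 5; 2; 1; 5; 4]
  [:: 0; 7; 6; 2; 4; 5]); by vm_compute.
Qed.

(** The contraction of the rim edges 0 and 2, the spoke 4 and the inner edge 0,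
    which has one more spanning tree than [optG]; its two vertices of degree 3
    are adjacent. *)
Definition tree_edges : seq (nat * nat) :=
  [:: (0, 1); (1, 2); (2, 0); (0, 3); (0, 4); (1, 3);
      (1, 5); (4, 5); (3, 2); (5, 3); (2, 4)].

Definition treeG : mgraph := lgraph 5 tree_edges.

Lemma weak_subdivision_tree : weak_subdivision petersen treeG.
Proof.
apply: (@petersen_contraction tree_edges [:: 0; 2; 9; 10]
  [:: 1; 3; 4; 5; 6; 7; 8; 11; 12; 13; 14] [:: 0; 0; 1; 1; 2; 3; 4; 3; 5; 2]
  [:: 0; 2; 4; 5; 6; 8]); by vm_compute.
Qed.

(** * Comparison of the graphs *)

Lemma nb_conn_tree5 : nb_conn treeG 5 = 225.
Proof. by rewrite nb_conn_lgraph; vm_compute. Qed.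

Lemma in_class_tree : in_class 6 11 treeG.
Proof.
split; rewrite ?card_ord //.
have : 0 < nb_conn treeG 5 by rewrite nb_conn_tree5.
case/card_gt0P=> S; rewrite inE => /andP[cS _].
by apply: spanning_connectedW cS; apply: subsetT.
Qed.

Lemma tree_not_iso_opt : ~ iso treeG optG.
Proof. by move=> /(iso_nb_conn 5); rewrite nb_conn_tree5 nb_conn_opt_tree. Qed.

Lemma nb_spanning_trees_opt_tree : nb_spanning_trees optG < nb_spanning_trees treeG.
Proof. by rewrite !nb_spanning_treesE !card_ord nb_conn_tree5 nb_conn_opt_tree. Qed.

Section Comparison.
Variable R : realType.
Local Open Scope ring_scope.

(** The threshold does not depend on [H], as uniform optimality near 1
    requires. *)
Lemma opt_wins_large (H : mgraph) : in_class 6 11 H ->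
  iso H optG \/
  forall p : R, 1 - threshold R 11%N < p < 1 -> reliability H p < reliability optG p.
Proof.
move=> classH; have [lex|] := disc_lex_or_near_regular classH; last first.
  by move/near_regular_iso; left.
right=> p pt; have [_ _ cardH] := classH.
have cardG : #|edge optG| = 11%N by rewrite card_ord.
have connH j : (j <= 11)%N -> (nb_conn H (11 - j) + nb_disc H j = 'C(11, j))%N.
  by move=> j11; rewrite -cardH nb_conn_disc // cardH.
have [N0 N1 N2 N3 N4] : [/\ nb_conn optG (11 - 0) = 1, nb_conn optG (11 - 1) = 11,
    nb_conn optG (11 - 2) = 55, nb_conn optG (11 - 3) = 163 &
    nb_conn optG (11 - 4) = 310]%N by case: nb_conn_opt.
have H0 : (nb_conn H (11 - 0) + nb_disc H 0 = 1)%N := connH 0 isT.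
have H1 : (nb_conn H (11 - 1) + nb_disc H 1 = 11)%N := connH 1 isT.
have H2 : (nb_conn H (11 - 2) + nb_disc H 2 = 55)%N := connH 2 isT.
have H3 : (nb_conn H (11 - 3) + nb_disc H 3 = 165)%N := connH 3 isT.
have H4 : (nb_conn H (11 - 4) + nb_disc H 4 = 330)%N := connH 4 isT.
have wins (k : nat) : (k <= 4)%N ->
    (forall j, (j < k)%N -> (nb_conn H (11 - j) <= nb_conn optG (11 - j))%N) ->
    (nb_conn H (11 - k) < nb_conn optG (11 - k))%N -> reliability H p < reliability optG p.
  move=> k4 le_j lt_k; apply: (@reliability_lt_large R optG H k p); rewrite cardG //.
  by apply: leq_trans k4 _.
case: lex => [d1|d2|d3|[d3 d4]].
- by apply: (wins 1%N) => // [[|j]|] //; lia.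
- by apply: (wins 2%N) => // [[|[|j]]|] //; lia.
- by apply: (wins 3%N) => // [[|[|[|j]]]|] //; lia.
- by apply: (wins 4%N) => // [[|[|[|[|j]]]]|] //; lia.
Qed.

Lemma between_lt1 (x y : R) : x < 1 -> y < 1 -> exists p : R, [/\ x < p, y < p & p < 1].
Proof.
move=> x1 y1; have m1 : Num.max x y < 1 by rewrite gt_max x1 y1.
exists ((Num.max x y + 1) / 2%:R); have [mx my] : x <= Num.max x y /\ y <= Num.max x y.
  by rewrite !le_max !lexx orbT.
by split; lra.
Qed.

Lemma opt_p_optimal : for_large_p (fun p : R => p_optimal 6 11 p optG).
Proof.
exists (1 - threshold R 11%N).
  by rewrite subr_gt0 threshold_lt1 gtrBl threshold_gt0.
move=> p pt; split=> [|H classH]; first exact: in_class_opt.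
by have [/iso_reliability->|/(_ p pt)/ltW] := opt_wins_large classH.
Qed.

Lemma p_optimal_iso_opt (H : mgraph) : in_class 6 11 H ->
  for_large_p (fun p : R => p_optimal 6 11 p H) -> iso H optG.
Proof.
move=> classH [p0 /andP[_ p01] optH].
have [//|wins] := opt_wins_large classH.
have t1 : 1 - threshold R 11%N < 1 by rewrite gtrBl threshold_gt0.
have [p [p0p tp p1]] := between_lt1 p01 t1.
have p0p1 : p0 < p < 1 by rewrite p0p.
have [_ /(_ optG in_class_opt)] := optH p p0p1.
by rewrite leNgt wins // tp.
Qed.

Lemma tree_wins_small (p : R) :
  0 < p < threshold R 11%N -> more_reliable p treeG optG.
Proof.
have cardT : #|edge treeG| = 11%N by rewrite card_ord.
rewrite -cardT => pt.
apply: (@reliability_lt_small R treeG optG 5%N p) pt => [||j j5|].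
- by rewrite !card_ord.
- by rewrite card_ord.
- by rewrite !nb_conn_small // card_ord.
- by rewrite nb_conn_tree5 nb_conn_opt_tree.
Qed.

Lemma no_uniquely_optimal : ~ exists G : mgraph, uniquely_optimal R 6 11 G.
Proof.
case=> U [classU winsU]; have t0 := threshold_gt0 R 11; have t1 := threshold_lt1 R 11.
have [Uopt|optU] := opt_wins_large classU; last first.
  have pt : 1 - threshold R 11%N < 1 - threshold R 11%N / 2%:R < 1 by apply/andP; split; lra.
  have p01 : 0 < 1 - threshold R 11%N / 2%:R < 1 by apply/andP; split; lra.
  have U_lt := optU _ pt.
  have NUopt : ~ iso optG U.
    by move=> /iso_reliability optE; move: U_lt; rewrite optE ltxx.
  have := winsU _ p01 _ in_class_opt NUopt; rewrite /more_reliable => /(lt_trans U_lt).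
  by rewrite ltxx.
have pt : 0 < threshold R 11%N / 2%:R < threshold R 11%N by apply/andP; split; lra.
have p01 : 0 < threshold R 11%N / 2%:R < 1 by apply/andP; split; lra.
have NtreeU : ~ iso treeG U.
  by move=> treeU; apply: tree_not_iso_opt; apply: iso_trans treeU Uopt.
have := winsU _ p01 _ in_class_tree NtreeU; rewrite /more_reliable (iso_reliability _ Uopt).
by move=> /(lt_trans (tree_wins_small pt)); rewrite ltxx.
Qed.

End Comparison.

Theorem proposition10p5 (R : realType) :
  (exists G : mgraph,
     (in_class 6 11 G /\
      for_large_p (fun p : R => p_optimal 6 11 p G) /\
      (forall H : mgraph, in_class 6 11 H ->
         for_large_p (fun p : R => p_optimal 6 11 p H) -> iso H G)) /\
     (forall H : mgraph,
        iso H G <->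
        [/\ simple_graph H,
            degree_sequence H = [:: 4; 4; 4; 4; 3; 3] &
            forall u v : vert H,
              degree u = 3 -> degree v = 3 -> ~~ adjacent u v]) /\
     iso G K6_minus_P4_K2 /\
     weak_subdivision petersen G /\
     (exists G' : mgraph,
        [/\ in_class 6 11 G', weak_subdivision petersen G', ~ iso G' G,
            nb_spanning_trees G < nb_spanning_trees G' &
            for_small_p (fun p : R => more_reliable p G' G)])) /\
  ~ (exists G : mgraph, uniquely_optimal R 6 11 G).
Proof.
split; last exact: no_uniquely_optimal.
exists optG; split; last split; last split; last split.
- split; first exact: in_class_opt.
  by split; [exact: opt_p_optimal | exact: p_optimal_iso_opt].
- move=> H; split=> [isoH|[simpleH degH nadjH]]; last first.
    by apply: near_regular_iso; apply: degree_sequence_near_regular.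
  split.
  + exact: iso_simple isoH simple_opt.
  + by rewrite (iso_degree_sequence isoH) degree_sequence_opt.
  + case: isoH => f [g [bij_f bij_g fg]] u v.
    rewrite -!(iso_degree bij_f bij_g fg) -(iso_adjacent bij_g fg).
    exact: nonadjacent_opt.
- exact: opt_iso_K6_minus_P4_K2.
- exact: weak_subdivision_opt.
exists treeG; split.
- exact: in_class_tree.
- exact: weak_subdivision_tree.
- exact: tree_not_iso_opt.
- exact: nb_spanning_trees_opt_tree.
exists (threshold R 11%N); last exact: tree_wins_small.
by rewrite threshold_gt0 threshold_lt1.
Qed.
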